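(* There exists a universal constant $c>0$ such that the following holds. Let $\varepsilon,\delta\in(0,1)$, set $K=\lceil 2/\varepsilon\rceil$, and let $X_1,\dots,X_m$ be a Markov chain on a finite state space $\mathcal{X}$ with ergodic transition matrix $P$, minimum stationary probability $\pi_\star$, pseudo-spectral gap $\gamma_{\mathsf{ps}}$ and arbitrary initial distribution. If $$m\ge\frac{c}{\gamma_{\mathsf{ps}}\pi_\star\varepsilon^2}\log\frac{1}{\pi_\star}\log\frac{1}{\pi_\star\varepsilon\delta}\log\frac{1}{\pi_\star\gamma_{\mathsf{ps}}\varepsilon\delta},$$ then with probability at least $1-\delta$ the estimator $\widehat{\gamma}_{\mathsf{ps},[K]}$ is well defined and $|\widehat{\gamma}_{\mathsf{ps},[K]}-\gamma_{\mathsf{ps}}|\le\varepsilon$.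
   Context: $P$ is row-stochastic on finite $\mathcal{X}$, ergodic (primitive), with unique stationary distribution $\pi>0$, $\pi_\star=\min_x\pi(x)$, time reversal $P^\star(x,x')=\pi(x')P(x',x)/\pi(x)$. For a transition matrix $Q$ with stationary $\pi$, $\gamma_\dagger(Q)=1-\lambda_2(Q^\star Q)$ ($\lambda_2$ = second largest eigenvalue counted with multiplicity), and $\gamma_{\mathsf{ps}}=\max_{k\ge1}\gamma_\dagger(P^k)/k$. The chain satisfies $\Pr(X_1=x_1,\dots,X_m=x_m)=\mu(x_1)\prod_{t}P(x_t,x_{t+1})$. For $k\ge1$ and $x,x'\in\mathcal{X}$ define $N^{(k)}_x=\sum_{t=1}^{\lfloor(m-1)/k\rfloor}\mathbf{1}\{X_{1+k(t-1)}=x\}$, $N^{(k)}_{xx'}=\sum_{t=1}^{\lfloor(m-1)/k\rfloor}\mathbf{1}\{X_{1+k(t-1)}=x,X_{1+kt}=x'\}$, and the matrix $\widehat{L}^{(k)}(x,x')=N^{(k)}_{xx'}/\sqrt{N^{(k)}_xN^{(k)}_{x'}}$ (defined when all $N^{(k)}_x>0$). For a real symmetric positive semidefinite matrix $M$ with eigenvalues $\lambda_1\ge\lambda_2\ge\dots$ counted with multiplicity, set $\gamma(M)=1-\lambda_2(M)$. The estimator is $\widehat{\gamma}_{\mathsf{ps},[K]}=\max_{k\in\{1,\dots,K\}}\frac1k\gamma\big((\widehat{L}^{(k)})^\intercal\widehat{L}^{(k)}\big)$. *)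

(* Defs.v *)
From HB Require Import structures.
From mathcomp Require Import all_boot all_order all_algebra.
From mathcomp Require Import all_classical all_reals all_analysis.
From mathcomp Require Import Rstruct Rstruct_topology.
From Stdlib Require Import ClassicalEpsilon.
Set Implicit Arguments. Unset Strict Implicit. Unset Printing Implicit Defensive.
Import Order.TTheory GRing.Theory Num.Theory.
Local Open Scope ring_scope.

Notation R := Rdefinitions.R.

Section Defs.
Variable n : nat.

Definition is_distribution (mu : 'rV[R]_n) : Prop :=
  (forall x, 0 <= mu 0 x) /\ \sum_x mu 0 x = 1.

Definition row_stochastic (P : 'M[R]_n) : Prop :=
  (forall x y, 0 <= P x y) /\ (forall x, \sum_y P x y = 1).

(* ergodic = primitive: some power has all entries positive *)
Definition primitive (P : 'M[R]_n) : Prop :=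
  exists k : nat, (0 < k)%N /\ forall x y, 0 < (P ^+ k) x y.

Definition stationary (P : 'M[R]_n) (pi : 'rV[R]_n) : Prop :=
  is_distribution pi /\ pi *m P = pi.

Definition pi_star (pi : 'rV[R]_n) : R := \big[Num.min/1]_x pi 0 x.

Definition reversal (pi : 'rV[R]_n) (Q : 'M[R]_n) : 'M[R]_n :=
  \matrix_(x, x') (pi 0 x' * Q x' x / pi 0 x).

Definition eigs_desc (A : 'M[R]_n) (s : seq R) : Prop :=
  sorted (fun a b => b <= a) s /\ char_poly A = \prod_(a <- s) ('X - a%:P).

(* second largest eigenvalue counted with multiplicity (only used on
   matrices whose spectrum is real, where such a list exists and is unique) *)
Definition lambda2 (A : 'M[R]_n) : R :=
  nth 0 (epsilon (inhabits [::]) (eigs_desc A)) 1.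

Definition gamma_mx (A : 'M[R]_n) : R := 1 - lambda2 A.

Definition gamma_dagger (pi : 'rV[R]_n) (Q : 'M[R]_n) : R :=
  gamma_mx (reversal pi Q *m Q).

(* pseudo-spectral gap: max_{k>=1} gamma_dagger(P^k)/k (written as a sup;
   the maximum is attained) *)
Definition gamma_ps (pi : 'rV[R]_n) (P : 'M[R]_n) : R :=
  sup [set g | exists k : nat, (0 < k)%N /\ g = gamma_dagger pi (P ^+ k) / k%:R].

(* ---- sample paths X_1..X_m, stored 0-indexed: X_{j+1} = w j ---- *)
Variable m : nat.
Definition cpath := {ffun 'I_m -> 'I_n}.

Definition Xopt (w : cpath) (j : nat) : option 'I_n := omap w (insub j).

Definition Popt (P : 'M[R]_n) (a b : option 'I_n) : R :=
  if a is Some x then (if b is Some y then P x y else 0) else 0.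

Definition path_prob (mu : 'rV[R]_n) (P : 'M[R]_n) (w : cpath) : R :=
  (if Xopt w 0 is Some x then mu 0 x else 0) *
  \prod_(t < m.-1) Popt P (Xopt w t) (Xopt w t.+1).

Definition prob (mu : 'rV[R]_n) (P : 'M[R]_n) (E : pred cpath) : R :=
  \sum_(w | E w) path_prob mu P w.

(* number of skip-k transitions: floor((m-1)/k); X_{1+k(t-1)} = w (k*(t-1)) *)
Definition nsteps (k : nat) : nat := (m.-1 %/ k)%N.

Definition Ncount (k : nat) (w : cpath) (x : 'I_n) : nat :=
  \sum_(t < nsteps k) (Xopt w (k * t) == Some x).

Definition Ncount2 (k : nat) (w : cpath) (x x' : 'I_n) : nat :=
  \sum_(t < nsteps k) ((Xopt w (k * t) == Some x) && (Xopt w (k * t + k) == Some x')).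

Definition Lhat (k : nat) (w : cpath) : 'M[R]_n :=
  \matrix_(x, x') ((Ncount2 k w x x')%:R /
                   Num.sqrt ((Ncount k w x)%:R * (Ncount k w x')%:R)).

Definition well_defined_K (K : nat) (w : cpath) : bool :=
  [forall k : 'I_K.+1, (0 < k)%N ==> [forall x, (0 < Ncount k w x)%N]].

Definition gamma_hat_k (w : cpath) (k : nat) : R :=
  gamma_mx ((Lhat k w)^T *m Lhat k w) / k%:R.

Definition gamma_ps_hat (K : nat) (w : cpath) : R :=
  \big[Num.max/gamma_hat_k w 1]_(1 <= k < K.+1) gamma_hat_k w k.

End Defs.

Definition Kparam (eps : R) : nat := `|Num.ceil (2 / eps)|%N.

(* Main.v *)
Require Import Defs.
From HB Require Import structures.
From mathcomp Require Import all_boot all_order all_algebra.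
From mathcomp Require Import all_classical all_reals all_analysis.
From mathcomp Require Import Rstruct Rstruct_topology.
From Stdlib Require Import ClassicalEpsilon.
From mathcomp Require Import complex ring lra zify.
Set Implicit Arguments. Unset Strict Implicit. Unset Printing Implicit Defensive.
Import Order.TTheory GRing.Theory Num.Theory.
Local Open Scope ring_scope.


(** The symmetrized k-step matrix L_k = D^{1/2} P^k D^{-1/2} satisfies
    gamma_dagger (P^k) = 1 - lambda2 (L_k^T L_k), so the proof compares the empirical matrix
    with L_k in operator norm, for each skip k <= K; larger skips contribute at most
    1/k <= eps/2.

    The transitions (x, y) at times k t are encoded by the rank-one matrices w^T w with
    w = (e_x / sqrt pi_x, e_y / sqrt pi_y), whose stationary mean is (1, L_k; L_k^T, 1).
    The times t are split into residue classes modulo a spacing s so large that the chain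
    is within a small relative error of pi between two consecutive samples of a class; this needs
    k s of order log (1/(pi_star eps)) / gamma_ps.  Along one class, the trace of the matrix
    exponential of the centred sums is multiplied in expectation by a factor close to 1
    at each step, by the Golden-Thompson inequality.  The exponential is replaced by
    (1 + S/N)^N with N a power of 2, so that Golden-Thompson reduces to the trace inequality
    tr (PQ)^N <= tr (P^N Q^N), and N tends to infinity only at the end.
    A union bound over skips, residue classes and signs concludes. *)

(** * Quadratic forms and the real spectral theorem *)

(** Two features keep the sample size at the stated order. Because [gamma_hat_k] is divided by [k],
    skip [k] only needs operator-norm accuracy of order [k eps]; the factor [k^2] gained in the tail
    exponent outweighs having only about [m / (k s)] samples in a residue class. And because a
    rank-one sample squares to at most [2 / pi_star] times itself, its second moment is of order
    [1 / pi_star] and not [1 / pi_star^2]. The chain need not be reversible, so the dependence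
    between samples is handled by conditioning alone: after the gap that precedes a sample, the law
    of the state lies between [1 - beta] and [1 + beta] times [pi], from every starting state.
    Closeness has to be multiplicative because that is what passes to nonnegative quadratic forms.
    The gap before the first sample of a class also removes the influence of the initial
    distribution. *)

Definition dot (F : nzRingType) n (u v : 'rV[F]_n) : F := (u *m v^T) 0 0.

Section Dot.
Context {F : realFieldType} {n : nat}.
Implicit Types (u v w : 'rV[F]_n) (A B : 'M[F]_n).

Lemma dotE u v : dot u v = \sum_i u 0 i * v 0 i.
Proof. by rewrite /dot mxE; apply: eq_bigr => i _; rewrite mxE. Qed.

Lemma dotC u v : dot u v = dot v u.
Proof. by rewrite !dotE; apply: eq_bigr => i _; rewrite mulrC. Qed.

Lemma dotDl u v w : dot (u + v) w = dot u w + dot v w.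
Proof. by rewrite /dot mulmxDl mxE. Qed.

Lemma dotDr u v w : dot w (u + v) = dot w u + dot w v.
Proof. by rewrite dotC dotDl !(dotC w). Qed.

Lemma dotZl a u v : dot (a *: u) v = a * dot u v.
Proof. by rewrite /dot -scalemxAl mxE. Qed.

Lemma dotZr a u v : dot u (a *: v) = a * dot u v.
Proof. by rewrite dotC dotZl dotC. Qed.

Lemma dotNl u v : dot (- u) v = - dot u v.
Proof. by rewrite -scaleN1r dotZl mulN1r. Qed.

Lemma dotNr u v : dot u (- v) = - dot u v.
Proof. by rewrite dotC dotNl dotC. Qed.

Lemma dotBl u v w : dot (u - v) w = dot u w - dot v w.
Proof. by rewrite dotDl dotNl. Qed.

Lemma dotBr u v w : dot w (u - v) = dot w u - dot w v.
Proof. by rewrite dotDr dotNr. Qed.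

Lemma dot0l u : dot 0 u = 0.
Proof. by rewrite /dot mul0mx mxE. Qed.

Lemma dot_suml (I : finType) (f : I -> 'rV[F]_n) v :
  dot (\sum_i f i) v = \sum_i dot (f i) v.
Proof. by rewrite /dot mulmx_suml summxE. Qed.

Lemma dotvv_ge0 v : 0 <= dot v v.
Proof. by rewrite dotE sumr_ge0 // => i _; rewrite -expr2 sqr_ge0. Qed.

Lemma dotvv_eq0 v : (dot v v == 0) = (v == 0).
Proof.
apply/idP/eqP => [|->]; last by rewrite dot0l.
rewrite dotE psumr_eq0 => [/allP h|i _]; last by rewrite -expr2 sqr_ge0.
apply/rowP => i; apply/eqP; rewrite mxE.
by have := h i (mem_index_enum _); rewrite /= -expr2 sqrf_eq0.
Qed.

Lemma dotvv_gt0 v : v != 0 -> 0 < dot v v.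
Proof. by move=> v0; rewrite lt_neqAle eq_sym dotvv_eq0 v0 dotvv_ge0. Qed.

Lemma dot_mulmxl (A : 'M[F]_n) u v : dot (u *m A) v = dot u (v *m A^T).
Proof. by rewrite /dot trmx_mul trmxK mulmxA. Qed.

Lemma dot_delta v i : dot v (delta_mx 0 i) = v 0 i.
Proof.
rewrite dotE (bigD1 i) //= big1 => [|j ji]; rewrite !mxE ?eqxx ?mulr1 ?addr0 //.
by rewrite eq_sym eq_sym (negbTE ji) andbF mulr0.
Qed.

(** The form may be degenerate, so the discriminant argument is run on whichever of [u], [v] has a
    nonzero value; if both values vanish, testing [u + v] and [u - v] kills the cross term.
    Degeneracy matters because the lemma is later applied to [mean_mx]. *)
Lemma psd_cauchy_schwarz A u v : A^T = A -> (forall w, 0 <= dot (w *m A) w) ->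
  dot (u *m A) v ^+ 2 <= dot (u *m A) u * dot (v *m A) v.
Proof.
move=> sA pA.
have c : dot (v *m A) u = dot (u *m A) v by rewrite dot_mulmxl sA dotC.
have h (a b : F) : 0 <= a ^+ 2 * dot (u *m A) u + 2 * a * b * dot (u *m A) v
     + b ^+ 2 * dot (v *m A) v.
  have := pA (a *: u + b *: v).
  by rewrite mulmxDl -!scalemxAl !(dotDl, dotDr, dotZl, dotZr) c;
    apply: etrans; congr (_ <= _); ring.
have a0 := pA u; have b0 := pA v.
set a := dot (u *m A) u in h a0 *; set b := dot (v *m A) v in h b0 *.
set x := dot (u *m A) v in h *.
have [a1|a1] := eqVneq a 0; last first.
  have ap : 0 < a by rewrite lt_neqAle eq_sym a1 a0.
  have := h x (- a); rewrite [X in 0 <= X](_ : _ = a * (a * b - x ^+ 2)); last by ring.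
  by rewrite pmulr_rge0 // subr_ge0.
have [b1|b1] := eqVneq b 0; last first.
  have bp : 0 < b by rewrite lt_neqAle eq_sym b1 b0.
  have := h (- b) x; rewrite [X in 0 <= X](_ : _ = b * (a * b - x ^+ 2)); last by ring.
  by rewrite pmulr_rge0 // subr_ge0.
have h1 := h 1 1; have h2 := h 1 (-1); rewrite a1 b1 in h1 h2 *.
have -> : x = 0 by lra.
by rewrite expr0n mul0r.
Qed.

Lemma cauchy_schwarz u v : dot u v ^+ 2 <= dot u u * dot v v.
Proof.
have := @psd_cauchy_schwarz 1%:M u v; rewrite trmx1 !mulmx1; apply=> // w.
by rewrite mulmx1 dotvv_ge0.
Qed.

End Dot.

Section Spectral.
Context {F : rcfType}.

(** A complex eigenvector [p + i q] for [x + i y] exists. Comparing [p A q] with [q A p] gives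
    [y (|p|^2 + |q|^2) = 0], so the eigenvalue is real and whichever of [p], [q] is nonzero is a
    real eigenvector. *)
Lemma symmetric_eigenvector n (A : 'M[F]_n.+1) : A^T = A ->
  exists a (p : 'rV[F]_n.+1), dot p p = 1 /\ p *m A = a *: p.
Proof.
move=> sA.
have [[x y] /eigenvalueP[v vA v0]] := @eigenvalue_closed _ _ (map_mx (real_complex F) A) isT.
pose p := map_mx (@complex.Re F) v; pose q := map_mx (@complex.Im F) v.
have ReD : {morph @complex.Re F : a b / a + b} by case=> [? ?] [? ?].
have ImD : {morph @complex.Im F : a b / a + b} by case=> [? ?] [? ?].
have pA : p *m A = x *: p - y *: q.
  apply/rowP => j; have /rowP/(_ j)/(congr1 (@complex.Re F)) := vA.
  rewrite !mxE (big_morph _ ReD (erefl _)).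
  case: (v 0 j) => [vr vi] /= <-; apply: eq_bigr => i _; rewrite !mxE.
  by case: (v 0 i) => [a b] /=; rewrite mulr0 subr0.
have qA : q *m A = x *: q + y *: p.
  apply/rowP => j; have /rowP/(_ j)/(congr1 (@complex.Im F)) := vA.
  rewrite !mxE (big_morph _ ImD (erefl _)).
  case: (v 0 j) => [vr vi] /= <-; apply: eq_bigr => i _; rewrite !mxE.
  by case: (v 0 i) => [a b] /=; rewrite mulr0 add0r.
have y0 : y * (dot p p + dot q q) = 0.
  have : dot (p *m A) q = dot (q *m A) p by rewrite dot_mulmxl sA dotC.
  rewrite pA qA !(dotDl, dotZl, dotNl, dotC q p) => h.
  by rewrite mulrDr; lra.
have pq : (p != 0) || (q != 0).
  rewrite -negb_and; apply: contra v0 => /andP[/eqP p0 /eqP q0].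
  apply/eqP/rowP => i; move/rowP/(_ i): p0; move/rowP/(_ i): q0; rewrite !mxE.
  by case: (v 0 i) => a b /= -> ->.
have s0 : 0 < dot p p + dot q q.
  by have := dotvv_ge0 p; have := dotvv_ge0 q; case/orP: pq => /dotvv_gt0 h; lra.
have {}y0 : y = 0 by move/eqP: y0; rewrite mulf_eq0 (gt_eqF s0) orbF => /eqP.
have [w w0 wA] : exists2 w : 'rV[F]_n.+1, w != 0 & w *m A = x *: w.
  rewrite y0 !scale0r subr0 in pA; rewrite y0 !scale0r addr0 in qA.
  by case/orP: pq => ?; [exists p|exists q].
have wp := dotvv_gt0 w0.
exists x, ((Num.sqrt (dot w w))^-1 *: w); split.
  by rewrite dotZl dotZr mulrA -expr2 exprVn sqr_sqrtr ?mulVf ?gt_eqF ?ltW.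
by rewrite -scalemxAl wA !scalerA mulrC.
Qed.

(* [H] is the Householder reflection along [p - delta_mx 0 0]. *)
Lemma orthogonal_to_delta n (p : 'rV[F]_n.+1) : dot p p = 1 ->
  exists H : 'M[F]_n.+1, [/\ H^T = H, H *m H = 1%:M & delta_mx 0 0 *m H = p].
Proof.
move=> pp; pose e : 'rV[F]_n.+1 := delta_mx 0 0.
have ee : dot e e = 1 by rewrite dot_delta mxE !eqxx.
have [->|/eqP pe] := eqVneq p e.
  by exists 1%:M; rewrite trmx1 !mulmx1.
pose w := p - e.
have w0 : dot w w != 0 by rewrite dotvv_eq0 subr_eq0; apply/eqP.
have ew : dot e w = - (dot w w / 2).
  by rewrite !(dotBl, dotBr) pp ee (dotC e p); lra.
have we : w = p - e by [].
clearbody w.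
pose H : 'M[F]_n.+1 := 1%:M - (2 / dot w w) *: (w^T *m w).
have wH (v : 'rV[F]_n.+1) : v *m H = v - (2 * dot v w / dot w w) *: w.
  rewrite mulmxBr mulmx1 -scalemxAr mulmxA [v *m w^T]mx11_scalar -/(dot v w).
  by rewrite mul_scalar_mx scalerA mulrAC.
have sH : H^T = H by rewrite /H linearB /= linearZ /= trmx_mul trmxK trmx1.
exists H; split => //.
  apply/row_matrixP => i; rewrite !rowE mulmxA mulmx1 !wH.
  set v := delta_mx _ _; rewrite dotBl dotZl mulfVK // -addrA -opprD -scalerDl.
  by rewrite [X in X *: w](_ : _ = 0) ?scale0r ?subr0 //; field.
rewrite -/e wH ew (_ : _ / _ = -1); last by field.
by rewrite scaleN1r opprK we addrC subrK.
Qed.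

(** Deflation: conjugation by a reflection that sends the first basis vector to a unit eigenvector
    clears the first row, hence by symmetry the first column, and the induction hypothesis applies
    to the remaining block. *)
Theorem symmetric_spectral n (A : 'M[F]_n) : A^T = A ->
  exists (Q : 'M[F]_n) (d : 'rV[F]_n),
    Q *m Q^T = 1%:M /\ A = Q^T *m diag_mx d *m Q.
Proof.
elim: n A => [|n IH] A sA.
  by exists 1%:M, 0; split; apply/matrixP => -[].
have [a [p [pp pA]]] := symmetric_eigenvector sA.
have [H [sH HH eH]] := orthogonal_to_delta pp.
pose B : 'M[F]_n.+1 := H *m A *m H.
have sB : B^T = B.
  by rewrite /B !trmx_mul sA sH; exact: mulmxA.
have eB : (delta_mx 0 0 : 'rV_n.+1) *m B = a *: delta_mx 0 0.
  by rewrite /B !mulmxA eH pA -scalemxAl -eH -mulmxA HH mulmx1.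
have AB : A = H *m B *m H by rewrite /B !mulmxA HH mul1mx -mulmxA HH mulmx1.
clearbody B.
have B0 (i j : 'I_n.+1) : i = 0 :> nat -> B i j = a * (val j == 0%N)%:R.
  move=> i0; have -> : i = 0 by exact: val_inj.
  by have := eB; move/rowP/(_ j); rewrite -rowE !mxE.
have [Q [d [QQ Ad]]] := IH (@drsubmx _ 1 n 1 n B) (etrans (@trmx_drsub _ 1 n 1 n B) (congr1 (@drsubmx _ 1 n 1 n) sB)).
have BE : B = @block_mx _ 1 n 1 n a%:M 0 0 (@drsubmx _ 1 n 1 n B).
  have -> : a%:M = @ulsubmx _ 1 n 1 n B.
    by apply/matrixP => i j; rewrite !ord1 !mxE B0 // mulr1.
  have e : @ursubmx _ 1 n 1 n B = 0.
    by apply/matrixP => i j; rewrite !ord1 !mxE B0 // mulr0.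
  rewrite -e; have -> : 0 = @dlsubmx _ 1 n 1 n B.
    by apply/matrixP => i j; rewrite !ord1 -sB !mxE B0 // mulr0.
  by rewrite submxK.
pose Q1 : 'M[F]_(1 + n) := block_mx 1%:M 0 0 Q.
have tQ1 : Q1^T = block_mx 1%:M 0 0 Q^T by rewrite /Q1 tr_block_mx !trmx0 trmx1.
pose e : 'rV[F]_(1 + n) := row_mx a%:M d.
have Q1Q1 : Q1 *m Q1^T = 1%:M.
  by rewrite tQ1 mulmx_block !mulmx0 !mul0mx mulmx1 !addr0 add0r QQ -scalar_mx_block.
have BQ : B = Q1^T *m diag_mx e *m Q1.
  rewrite BE Ad tQ1 /e diag_mx_row !mulmx_block.
  rewrite !mulmx0 !mul0mx !mulmx1 !mul1mx !addr0 !add0r.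
  have -> : diag_mx (a%:M : 'rV_1) = a%:M by apply/matrixP => i j; rewrite !ord1 !mxE.
  by rewrite mul0mx.
clearbody Q1 e.
exists ((Q1 : 'M[F]_n.+1) *m H), e; split.
  rewrite trmx_mul sH mulmxA -(mulmxA (Q1 : 'M[F]_n.+1)) HH mulmx1; exact: Q1Q1.
rewrite AB BQ trmx_mul sH !mulmxA; congr (_ *m _).
Qed.

End Spectral.

Lemma char_poly_conj (F : fieldType) n (P Q A : 'M[F]_n) : P *m Q = 1%:M ->
  char_poly (P *m A *m Q) = char_poly A.
Proof.
move=> PQ; rewrite /char_poly.
have PQX : map_mx polyC P *m map_mx polyC Q = 1%:M by rewrite -map_mxM PQ map_mx1.
have -> : char_poly_mx (P *m A *m Q) = map_mx polyC P *m char_poly_mx A *m map_mx polyC Q.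
  rewrite /char_poly_mx mulmxBr mulmxBl !map_mxM; congr (_ - _).
  by rewrite scalar_mxC -mulmxA PQX mulmx1.
by rewrite !det_mulmx mulrAC -det_mulmx PQX det1 mul1r.
Qed.

Section SpectralBasis.
Context {F : rcfType}.

Lemma spectral_basis n (A : 'M[F]_n) : A^T = A ->
  exists (u : 'I_n -> 'rV[F]_n) (d : 'I_n -> F),
  [/\ forall i j, dot (u i) (u j) = (i == j)%:R,
      forall i, u i *m A = d i *: u i,
      forall v, v = \sum_i dot v (u i) *: u i,
      char_poly A = \prod_i ('X - (d i)%:P) &
      forall M, \tr M = \sum_i dot (u i *m M) (u i)].
Proof.
move=> /symmetric_spectral[Q [d [QQ AE]]].
have QQ' : Q^T *m Q = 1%:M by apply: mulmx1C.
exists (fun i => row i Q), (fun i => d 0 i); split.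
- move=> i j; rewrite dotE; move/matrixP/(_ i j): QQ; rewrite !mxE => <-.
  by apply: eq_bigr => k _; rewrite !mxE.
- move=> i; rewrite AE !rowE !mulmxA -(mulmxA _ Q) QQ mulmx1.
  by rewrite -rowE row_diag_mx -scalemxAl.
- move=> v; rewrite -{1}[v]mulmx1 -QQ' mulmxA mulmx_sum_row; apply: eq_bigr => i _.
  congr (_ *: _); rewrite dotE !mxE; apply: eq_bigr => j _; by rewrite !mxE.
- rewrite AE char_poly_conj // char_poly_trig ?diag_mx_is_trig //.
  by apply: eq_bigr => i _; rewrite mxE eqxx mulr1n.
- move=> M; rewrite -{1}[M]mulmx1 -QQ' mulmxA mxtrace_mulC mulmxA.
  apply: eq_bigr => i _; rewrite dotE !mxE; apply: eq_bigr => j _.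
  by rewrite -row_mul !mxE.
Qed.

Lemma form_eigen n (A : 'M[F]_n) (u : 'I_n -> 'rV[F]_n) (d : 'I_n -> F) (v : 'rV[F]_n) :
  (forall i j, dot (u i) (u j) = (i == j)%:R) -> (forall i, u i *m A = d i *: u i) ->
  (forall v, v = \sum_i dot v (u i) *: u i) ->
  dot (v *m A) v = \sum_i d i * dot v (u i) ^+ 2.
Proof.
move=> uu uA uE; rewrite {1 2}[v]uE mulmx_suml dot_suml; apply: eq_bigr => i _.
by rewrite -scalemxAl uA !dotZl -uE (dotC (u i)); ring.
Qed.

Lemma dotvv_basis n (u : 'I_n -> 'rV[F]_n) (v : 'rV[F]_n) :
  (forall v, v = \sum_i dot v (u i) *: u i) -> dot v v = \sum_i dot v (u i) ^+ 2.
Proof.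
move=> uE; rewrite {1}[v]uE dot_suml; apply: eq_bigr => i _.
by rewrite dotZl (dotC (u i)) expr2.
Qed.

End SpectralBasis.

(** * Perturbation of the second eigenvalue *)

Section SecondEigenvalue.
Context {n : nat} (n_gt1 : (1 < n)%N).
Implicit Types (A B : 'M[R]_n) (v : 'rV[R]_n).

(** The list picked by [epsilon] is identified through uniqueness: two sorted lists with the same
    product of linear factors are permutations of each other, hence equal. As [1 < n], the default
    value of [nth] is never read. *)
Lemma lambda2_eigen A : A^T = A ->
  exists (p q : 'rV[R]_n) a, [/\ dot p p = 1, dot q q = 1, dot p q = 0,
    p *m A = a *: p & q *m A = lambda2 A *: q] /\ lambda2 A <= a /\
    forall v, dot v p = 0 -> dot (v *m A) v <= lambda2 A * dot v v.
Proof.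
move=> /spectral_basis[u [d [uu uA uE cA _]]].
have n_gt0 : (0 < n)%N by apply: ltn_trans n_gt1.
pose leT := fun i j : 'I_n => d j <= d i.
have leT_tr : transitive leT by move=> j i k ij jk; apply: le_trans ij.
have leT_total : total leT by move=> i j; apply: le_total.
pose t := sort leT (enum 'I_n).
have st : size t = n by rewrite size_sort size_enum_ord.
have tt : sorted leT t by apply: sort_sorted.
have ut : uniq t by rewrite sort_uniq enum_uniq.
have Et : eigs_desc A (map d t).
  split; first by rewrite sorted_map.
  by rewrite cA big_map [RHS](perm_big (enum 'I_n)) ?perm_sort // big_enum.
have Ee : eigs_desc A (epsilon (inhabits [::]) (eigs_desc A)).
  by apply: epsilon_spec; exists (map d t).
have l2E : lambda2 A = nth 0 (map d t) 1.
  rewrite /lambda2; congr (nth _ _ _); apply: (@sorted_eq _ (fun a b : R => b <= a)).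
  - by move=> b a c ab bc; apply: le_trans ab.
  - by move=> a b; rewrite andbC => /le_anti.
  - by case: Ee.
  - by case: Et.
  - by apply: prod_XsubC_eq; rewrite -(proj2 Ee) (proj2 Et).
pose i0 := nth (Ordinal n_gt0) t 0; pose i1 := nth (Ordinal n_gt0) t 1.
have {}l2E : lambda2 A = d i1 by rewrite l2E (nth_map (Ordinal n_gt0)) ?st.
have i01 : i0 != i1 by rewrite nth_uniq ?st.
have dle i : i != i0 -> d i <= d i1.
  have it : i \in t by rewrite mem_sort mem_enum.
  move=> ii; rewrite -(nth_index (Ordinal n_gt0) it).
  have ind : (0 < index i t)%N.
    by rewrite lt0n; apply: contra ii => /eqP h; move: (nth_index (Ordinal n_gt0) it); rewrite h /i0 => ->.
  apply: (sorted_leq_nth leT_tr (fun x => lexx _) (Ordinal n_gt0) tt) => //.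
    by rewrite inE st.
  by rewrite inE index_mem.
exists (u i0), (u i1), (d i0); split.
  by split; rewrite ?uu ?eqxx ?(negbTE i01) // ?uA // l2E.
split.
  rewrite l2E; apply: (sorted_leq_nth leT_tr (fun x => lexx _) (Ordinal n_gt0) tt);
    by rewrite ?inE ?st.
move=> v vp; rewrite (form_eigen _ uu uA uE) (dotvv_basis _ uE) l2E mulr_sumr.
apply: ler_sum => i _; have [->|ii] := eqVneq i i0; first by rewrite vp expr0n !mulr0.
by apply: ler_wpM2r; rewrite ?sqr_ge0 ?dle.
Qed.

(* The span of the two leading eigenvectors meets every hyperplane (Courant-Fischer). *)
Lemma lambda2_le_hyperplane A (h : 'rV[R]_n) : A^T = A ->
  exists v, [/\ v != 0, dot v h = 0 & lambda2 A * dot v v <= dot (v *m A) v].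
Proof.
move=> /lambda2_eigen[p [q [a [[pp qq pq pA qA] [la _]]]]].
have key x y : let v := x *: p + y *: q in
    lambda2 A * dot v v <= dot (v *m A) v /\ dot v v = x ^+ 2 + y ^+ 2.
  rewrite /= mulmxDl -!scalemxAl pA qA !(dotDl, dotDr, dotZl, dotZr) pp qq pq (dotC q) pq.
  split; last by ring.
  rewrite -subr_ge0 [X in 0 <= X](_ : _ = x ^+ 2 * (a - lambda2 A)); last by ring.
  by rewrite mulr_ge0 ?sqr_ge0 ?subr_ge0.
have [ph|ph] := eqVneq (dot p h) 0.
  exists p; split => //; first by rewrite -dotvv_eq0 pp oner_eq0.
  by have [] := key 1 0; rewrite scale1r scale0r addr0.
exists (dot q h *: p + (- dot p h) *: q); have [k1 k2] := key (dot q h) (- dot p h).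
split=> //; last by rewrite dotDl !dotZl; ring.
rewrite -dotvv_eq0 k2 gt_eqF // sqrrN ltr_wpDl ?sqr_ge0 //.
by rewrite lt_neqAle eq_sym sqrf_eq0 ph sqr_ge0.
Qed.

Lemma lambda2_perturb A B eta : A^T = A -> B^T = B ->
  (forall v, dot (v *m A) v <= dot (v *m B) v + eta * dot v v) ->
  lambda2 A <= lambda2 B + eta.
Proof.
move=> sA sB h; have [p [_ [_ [_ [_ lB]]]]] := lambda2_eigen sB.
have [v [v0 vp vA]] := lambda2_le_hyperplane p sA.
rewrite -(ler_pM2r (dotvv_gt0 v0)) mulrDl; apply: (le_trans vA).
by apply: (le_trans (h v)); rewrite lerD2r lB.
Qed.

Lemma lambda2_ge0 A : A^T = A -> (forall v, 0 <= dot (v *m A) v) -> 0 <= lambda2 A.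
Proof.
move=> sA pA; have [p [q [a [[pp qq pq _ _] [_ lA]]]]] := lambda2_eigen sA.
by have := lA q; rewrite dotC pq qq mulr1 => /(_ erefl); apply: le_trans.
Qed.

Lemma lambda2_le1 A : A^T = A -> (forall v, dot (v *m A) v <= dot v v) -> lambda2 A <= 1.
Proof.
move=> sA pA; have [p [q [a [[pp qq pq pA' qA] _]]]] := lambda2_eigen sA.
by have := pA q; rewrite qA dotZl qq mulr1.
Qed.

Lemma lambda2_ge_complement A (h v : 'rV[R]_n) : A^T = A -> h *m A = h -> dot h h = 1 ->
  (forall v, dot (v *m A) v <= dot v v) -> dot v h = 0 ->
  dot (v *m A) v <= lambda2 A * dot v v.
Proof.
move=> sA hA hh cA vh; have [p [_ [_ [_ [_ lA]]]]] := lambda2_eigen sA.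
have l1 := lambda2_le1 sA cA.
have vAh : dot (v *m A) h = 0 by rewrite dot_mulmxl sA hA.
have hAv : dot (h *m A) v = 0 by rewrite hA dotC.
have key x y : x * dot v p + y * dot h p = 0 ->
    x ^+ 2 * dot (v *m A) v + y ^+ 2 <= lambda2 A * (x ^+ 2 * dot v v + y ^+ 2).
  move=> e; have := lA (x *: v + y *: h).
  rewrite mulmxDl -!scalemxAl !(dotDl, dotDr, dotZl, dotZr) vAh hAv e hA hh vh (dotC h v) vh.
  by move=> /(_ erefl) hx; apply: etrans hx; congr (_ <= _); ring.
have [hp|hp] := eqVneq (dot h p) 0.
  have := key 0 1; rewrite hp; rewrite !(mul0r, mulr0, addr0, add0r, expr0n, expr1n, mulr1) => /(_ erefl).
  move=> l1'; have -> : lambda2 A = 1 by apply/eqP; rewrite eq_le l1 l1'.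
  by rewrite mul1r.
have := key (dot h p) (- dot v p); rewrite mulNr mulrC subrr => /(_ erefl).
set x := dot h p in hp *; set y := - _ => k.
have x2 : 0 < x ^+ 2 by rewrite lt_neqAle eq_sym sqrf_eq0 hp sqr_ge0.
rewrite -(ler_pM2l x2); have y2 : 0 <= y ^+ 2 by apply: sqr_ge0.
by have := mulr_ge0 y2 (_ : 0 <= 1 - lambda2 A); rewrite subr_ge0 => /(_ l1); lra.
Qed.

End SecondEigenvalue.

(** * Golden-Thompson inequality *)

Section TracePower.
Context {F : rcfType} {n : nat}.
Implicit Types (A B M P Q : 'M[F]_n).

Lemma trmxX A k : (A ^+ k)^T = A^T ^+ k.
Proof.
elim: k => [|k IH]; first by rewrite !expr0 trmx1.
by rewrite exprS -mulmxE trmx_mul IH exprSr.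
Qed.

Lemma mxtraceM_C A B : \tr (A * B) = \tr (B * A).
Proof. by rewrite -!mulmxE mxtrace_mulC. Qed.

Lemma mxtrace_expM_C A B k : \tr ((A * B) ^+ k) = \tr ((B * A) ^+ k).
Proof.
case: k => [|k]; first by rewrite !expr0.
have h m : (A * B) ^+ m * A = A * (B * A) ^+ m.
  elim: m => [|m IH]; first by rewrite !expr0 mul1r mulr1.
  by rewrite exprS -!mulrA IH exprS !mulrA.
by rewrite exprSr mulrA h mxtraceM_C mulrA -exprS.
Qed.

Lemma mxtrace_cauchy_schwarz A B :
  \tr (A *m B^T) ^+ 2 <= \tr (A *m A^T) * \tr (B *m B^T).
Proof.
have h (C D : 'M[F]_n) : \tr (C *m D^T) = dot (mxvec C) (mxvec D).
  rewrite dotE (reindex _ (curry_mxvec_bij n n)) /= /mxtrace.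
  rewrite (eq_bigr (fun p : 'I_n * 'I_n =>
    mxvec C 0 (mxvec_index p.1 p.2) * mxvec D 0 (mxvec_index p.1 p.2))) => [|[i j] _ //].
  rewrite -(pair_bigA _ (fun i j => mxvec C 0 (mxvec_index i j) * mxvec D 0 (mxvec_index i j))) /=.
  by apply: eq_bigr => i _; rewrite !mxE; apply: eq_bigr => j _; rewrite !mxvecE !mxE.
by rewrite !h cauchy_schwarz.
Qed.

Lemma mxtrace_mul_le A B t : \tr (A *m A^T) = t -> \tr (B *m B^T) = t ->
  \tr (A *m B^T) <= t.
Proof.
move=> At Bt; have := mxtrace_cauchy_schwarz A B; rewrite At Bt -expr2.
have t0 : 0 <= t.
  rewrite -At /mxtrace sumr_ge0 // => i _; rewrite mxE sumr_ge0 // => j _.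
  by rewrite !mxE -expr2 sqr_ge0.
by move=> h; rewrite leNgt; apply/negP => tl; move: h; rewrite leNgt ltr_pXn2r ?nnegrE ?tl // (le_trans t0) ?ltW.
Qed.

(** The two inequalities feed each other. The first at [k + 1] is the second for [M = P Q], a cyclic
    shift turning [P Q^2 P] into [P^2 Q^2], and the first for the squares. The second at [k + 1] is
    the second for [M^2], the first for [M M^T] and [M^T M], and Cauchy-Schwarz for the trace. *)
Lemma mxtrace_pow2_le k :
  (forall P Q, P^T = P -> Q^T = Q ->
     \tr ((P * Q) ^+ (2 ^ k)) <= \tr (P ^+ (2 ^ k) * Q ^+ (2 ^ k))) /\
  (forall M, \tr (M ^+ (2 ^ k.+1)) <= \tr ((M * M^T) ^+ (2 ^ k))).
Proof.
elim: k => [|k [IHG IHM]].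
  split=> [P Q _ _|M]; first by rewrite !expr1.
  rewrite expn1 expn0 expr1 expr2 -!mulmxE -{2}[M]trmxK.
  by apply: mxtrace_mul_le => //; rewrite trmxK mxtrace_mulC.
have sMM (M : 'M[F]_n) : (M * M^T)^T = M * M^T by rewrite -mulmxE trmx_mul trmxK.
split=> [P Q sP sQ|M].
  apply: (le_trans (IHM _)).
  have -> : (P * Q) * (P * Q)^T = P * (Q ^+ 2 * P).
    by rewrite -[in X in _ * X]mulmxE trmx_mul sP sQ mulmxE expr2 !mulrA.
  rewrite mxtrace_expM_C -mulrA -expr2 mxtrace_expM_C.
  have := IHG (P ^+ 2) (Q ^+ 2); rewrite !trmxX sP sQ -!exprM -!expnS => /(_ erefl erefl).
  by rewrite mxtrace_expM_C.
rewrite expnS exprM; apply: (le_trans (IHM _)).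
have -> : M ^+ 2 * (M ^+ 2)^T = M * (M * M^T * M^T) by rewrite trmxX !expr2 !mulrA.
rewrite mxtrace_expM_C -mulrA.
have sMM' : (M^T * M)^T = M^T * M by rewrite -mulmxE trmx_mul trmxK.
apply: (le_trans (IHG _ _ (sMM _) sMM')).
have e : ((M^T * M) ^+ (2 ^ k))^T = (M^T * M) ^+ (2 ^ k) by rewrite trmxX sMM'.
rewrite -e -mulmxE; apply: mxtrace_mul_le; rewrite trmxX ?sMM ?sMM' mulmxE -exprD addnn -mul2n -expnS //.
by rewrite mxtrace_expM_C.
Qed.

End TracePower.

Section RowBound.
Context {F : realType} {n : nat}.
Implicit Types (A B U V : 'M[F]_n) (a b c : F).

(** A bound on the row-sum norm, which is submultiplicative and gives the identity norm 1. It only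
    serves to control the noncommutativity error, which vanishes as [N] grows, so its size is
    irrelevant. *)
Definition rowbound A c := forall i, \sum_j `|A i j| <= c.

Lemma rowbound1 : rowbound 1 1.
Proof.
move=> i; rewrite (bigD1 i) //= big1 => [|j ji]; rewrite mxE ?eqxx ?normr1 ?addr0 //.
by rewrite eq_sym (negbTE ji) normr0.
Qed.

Lemma rowboundD A B a b : rowbound A a -> rowbound B b -> rowbound (A + B) (a + b).
Proof.
move=> hA hB i; apply: le_trans (lerD (hA i) (hB i)).
by rewrite -big_split /=; apply: ler_sum => j _; rewrite mxE ler_normD.
Qed.

Lemma rowboundZ A a x : 0 <= x -> rowbound A a -> rowbound (x *: A) (x * a).
Proof.
move=> x0 hA i; apply: le_trans (ler_wpM2l x0 (hA i)).
by rewrite mulr_sumr; apply: ler_sum => j _; rewrite mxE normrM (ger0_norm x0).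
Qed.

Lemma rowboundM A B a b : 0 <= b -> rowbound A a -> rowbound B b -> rowbound (A * B) (a * b).
Proof.
move=> b0 hA hB i; apply: (@le_trans _ _ (\sum_j \sum_k `|A i k| * `|B k j|)).
  apply: ler_sum => j _; rewrite -mulmxE mxE (le_trans (ler_norm_sum _ _ _)) //.
  by apply: ler_sum => k _; rewrite normrM.
rewrite exchange_big /=; apply: le_trans (ler_wpM2r b0 (hA i)).
rewrite mulr_suml; apply: ler_sum => k _; rewrite -mulr_sumr.
by rewrite ler_wpM2l.
Qed.

Lemma rowboundW A a b : a <= b -> rowbound A a -> rowbound A b.
Proof. by move=> ab hA i; apply: le_trans ab. Qed.

Lemma rowboundN A a : rowbound A a -> rowbound (- A) a.
Proof. by move=> hA i; apply: le_trans (hA i); apply: ler_sum => j _; rewrite mxE normrN. Qed.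

Lemma rowboundX A a k : 0 <= a -> rowbound A a -> rowbound (A ^+ k) (a ^+ k).
Proof.
move=> a0 hA; elim: k => [|k IH]; first by rewrite !expr0; exact: rowbound1.
by rewrite !exprS; apply: rowboundM; rewrite ?exprn_ge0.
Qed.

Lemma mxtrace_rowbound A a : rowbound A a -> \tr A <= n%:R * a.
Proof.
move=> hA; apply: (@le_trans _ _ (\sum_(i < n) a)); last first.
  by rewrite sumr_const card_ord mulr_natl.
apply: ler_sum => i _; apply: le_trans (hA i); rewrite (bigD1 i) //=.
by apply: (le_trans (ler_norm _)); rewrite lerDl sumr_ge0.
Qed.

Lemma rowbound_exists A : exists2 a, 0 <= a & rowbound A a.
Proof.
exists (\sum_i \sum_j `|A i j|).
  by apply: sumr_ge0 => i _; apply: sumr_ge0.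
move=> i; rewrite [X in _ <= X](bigD1 i) //= lerDl.
by apply: sumr_ge0 => k _; apply: sumr_ge0.
Qed.

(** Telescoping produces powers [c ^ (k - 1)]; the assumption [1 <= c] allows the cruder [c ^ k]. *)
Lemma rowbound_subX U V c d k : 1 <= c -> 0 <= d -> rowbound U c -> rowbound V c ->
  rowbound (U - V) d -> rowbound (U ^+ k - V ^+ k) (k%:R * c ^+ k * d).
Proof.
move=> c1 d0 hU hV hUV; have c0 : 0 <= c by apply: le_trans c1.
elim: k => [|k IH].
  by rewrite !expr0 subrr !mul0r => i; rewrite big1 // => j _; rewrite mxE normr0.
have -> : U ^+ k.+1 - V ^+ k.+1 = U * (U ^+ k - V ^+ k) + (U - V) * V ^+ k.
  by rewrite mulrBr mulrBl -!exprS addrA subrK.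
have ck : 0 <= c ^+ k by apply: exprn_ge0.
have b1 : rowbound (U * (U ^+ k - V ^+ k)) (c * (k%:R * c ^+ k * d)).
  by apply: rowboundM; rewrite ?mulr_ge0.
have b2 := rowboundM ck hUV (rowboundX k c0 hV).
apply: rowboundW (rowboundD b1 b2).
rewrite exprS -natr1 -subr_ge0.
rewrite [X in 0 <= X](_ : _ = (c - 1) * (c ^+ k * d)); last by ring.
by rewrite !mulr_ge0 ?subr_ge0.
Qed.

(* Golden-Thompson with the exponentials replaced by their Euler approximants:
   1 + (A+B)/N and (1 + A/N)(1 + B/N) differ by AB/N^2 only. *)
Lemma golden_thompson_euler A B a b k : A^T = A -> B^T = B -> 0 <= a -> 0 <= b ->
  rowbound A a -> rowbound B b -> let N := (2 ^ k)%N in let x := N%:R^-1 : F in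
  \tr ((1 + x *: (A + B)) ^+ N) <=
  \tr ((1 + x *: A) ^+ N * (1 + x *: B) ^+ N) + n%:R * (a * b * expR (a + b)) * x.
Proof.
move=> sA sB a0 b0 hA hB; set N := (2 ^ k)%N; move=> /=; set x := _^-1.
have N0 : 0 < N%:R :> F by rewrite ltr0n expn_gt0.
have x0 : 0 <= x by rewrite invr_ge0 ltW.
set U := 1 + x *: (A + B); pose V := (1 + x *: A) * (1 + x *: B).
(* With this choice [c ^ N = expR (a + b)] for every [N], so the telescoping bound [N c^N (a b x^2)]
   is a fixed constant times [1 / N]. *)
pose c := expR (x * (a + b)).
have s1 (C : 'M[F]_n) : C^T = C -> (1 + x *: C)^T = 1 + x *: C.
  by move=> sC; rewrite linearD linearZ /= sC trmx1.
have hV : \tr (V ^+ N) <= \tr ((1 + x *: A) ^+ N * (1 + x *: B) ^+ N).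
  by apply: (proj1 (mxtrace_pow2_le k)); apply: s1.
have cN : c ^+ N = expR (a + b).
  by rewrite -expRM_natl mulrA mulfV ?mul1r ?gt_eqF.
have bU : rowbound U c.
  apply: rowboundW (expR_ge1Dx _) _; apply: rowboundD (rowbound1) _.
  by apply: rowboundZ => //; apply: rowboundD.
have bV : rowbound V c.
  have h1 := rowboundD rowbound1 (rowboundZ x0 hA).
  have h2 := rowboundD rowbound1 (rowboundZ x0 hB).
  rewrite /c mulrDr exp.expRD; apply: rowboundW (rowboundM _ h1 h2).
    by rewrite ler_pM ?expR_ge1Dx // addr_ge0 // mulr_ge0.
  by rewrite addr_ge0 // mulr_ge0.
have bUV : rowbound (U - V) (x * (x * (a * b))).
  have -> : U - V = - (x *: (x *: (A * B))).
    rewrite /U /V mulrDl mul1r mulrDr mulr1.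
    have -> : x *: A * (x *: B) = x *: (x *: (A * B)).
      by rewrite -!mulmxE -scalemxAl -scalemxAr.
    by apply/matrixP=> i j; rewrite !mxE; ring.
  by apply: rowboundN; do 2 apply: rowboundZ => //; apply: rowboundM.
have c1 : 1 <= c by apply: le_trans (expR_ge1Dx _); rewrite lerDl mulr_ge0 ?addr_ge0.
have d0 : 0 <= x * (x * (a * b)) by rewrite !mulr_ge0.
have := mxtrace_rowbound (rowbound_subX N c1 d0 bU bV bUV).
rewrite raddfB /= lerBlDl => h; apply: (le_trans h); apply: lerD => //.
rewrite cN -subr_ge0 [X in 0 <= X](_ : _ = 0) // /x; field.
by rewrite gt_eqF.
Qed.

End RowBound.

(** * Matrix Laplace transform along a chain *)

Section ScalarExp.
Context {F : realType}.

(** Multiply by [1 - x], which is at most [expR (- x)]: the polynomial side becomes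
    [1 + x^2 (1 - 2 x)]. *)
Lemma expR_le_quadratic (x : F) : x <= 1 / 2 -> expR x <= 1 + x + 2 * x ^+ 2.
Proof.
move=> x2; have h := expR_ge1Dx (- x); have e0 := expR_gt0 x.
have ee : expR x * expR (- x) = 1 by rewrite -exp.expRD subrr exp.expR0.
have p0 : 0 <= 1 + x + 2 * x ^+ 2 by have := sqr_ge0 (x + 1 / 4); nra.
have q0 : 0 < 1 - x by lra.
rewrite -(ler_pM2r q0); apply: (@le_trans _ _ 1).
  by have := ler_wpM2l (ltW e0) h; rewrite ee.
rewrite -subr_ge0 [X in 0 <= X](_ : _ = x ^+ 2 * (1 - 2 * x)); last by ring.
by rewrite mulr_ge0 ?sqr_ge0 //; lra.
Qed.

Lemma expR_half_le (y : F) : 0 <= y <= 1 -> expR (y / 2) <= 1 + y.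
Proof.
move=> /andP[y0 y1]; have h := expR_ge1Dx (- (y / 2)).
have ee : expR (y / 2) * expR (- (y / 2)) = 1 by rewrite -exp.expRD subrr exp.expR0.
have q0 : 0 < 1 - y / 2 by lra.
rewrite -(ler_pM2r q0); apply: (@le_trans _ _ 1).
  by have := ler_wpM2l (expR_ge0 (y / 2)) h; rewrite ee.
by have := mulr_ge0 y0 (_ : 0 <= 1 - y); rewrite subr_ge0 => /(_ y1); nra.
Qed.

Lemma euler_le_expR (y : F) N : (0 < N)%N -> - N%:R <= y -> (1 + N%:R^-1 * y) ^+ N <= expR y.
Proof.
move=> N0 yN; have Np : 0 < N%:R :> F by rewrite ltr0n.
have -> : y = N%:R * (N%:R^-1 * y) by rewrite mulrA mulfV ?mul1r ?gt_eqF.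
rewrite expRM_natl (mulKf (lt0r_neq0 Np)); apply: lerXn2r; rewrite ?nnegrE ?expR_ge0 ?expR_ge1Dx //.
rewrite -[X in X + _](@mulVf _ N%:R) ?gt_eqF // -mulrDr; apply: mulr_ge0.
  by rewrite invr_ge0 ltW.
by rewrite -lerBlDl sub0r.
Qed.

End ScalarExp.

Section EulerPotential.
Context {F : realType} {n : nat}.
Implicit Types (S X Y Q : 'M[F]_n) (v : 'rV[F]_n).

(* [(1 + S / 2^k)^(2^k)], a polynomial stand-in for the matrix exponential. *)
Definition euler k S : 'M[F]_n := (1 + ((2 ^ k)%N%:R^-1 : F) *: S) ^+ (2 ^ k).

Lemma euler_eigen k S v d : v *m S = d *: v ->
  v *m euler k S = (1 + (2 ^ k)%N%:R^-1 * d) ^+ (2 ^ k) *: v.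
Proof.
move=> vS; rewrite /euler; move: (_%:R^-1) => x; elim: (2 ^ k)%N => [|m IH].
  by rewrite !expr0 mulmx1 scale1r.
rewrite !exprS -mulmxE mulmxA mulmxDr mulmx1 -scalemxAr vS scalerA.
by rewrite -{1}[v]scale1r -scalerDl -scalemxAl IH scalerA.
Qed.

Lemma euler0 k : euler k 0 = 1.
Proof. by rewrite /euler scaler0 addr0 expr1n. Qed.

(** For [0 < k] the exponent is even, so [euler k S] is positive semidefinite however large [S] is
    compared with [2 ^ k]. *)
Lemma euler_coef_ge0 k (d : F) : (0 < k)%N -> 0 <= (1 + (2 ^ k)%N%:R^-1 * d) ^+ (2 ^ k).
Proof. by case: k => // k _; rewrite [X in _ ^+ X]expnS exprM exprn_ge0 // sqr_ge0. Qed.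

Lemma euler_trace_mul_le k S Q rho : (0 < k)%N -> S^T = S ->
  (forall v, dot (v *m Q) v <= rho * dot v v) ->
  \tr (euler k S * Q) <= rho * \tr (euler k S).
Proof.
move=> k0 /spectral_basis[u [d [uu uS _ _ trE]]] hQ.
rewrite !trE mulr_sumr; apply: ler_sum => i _.
rewrite -mulmxE mulmxA (euler_eigen k (uS i)) -scalemxAl !dotZl mulrCA.
by rewrite ler_wpM2l ?euler_coef_ge0.
Qed.

Lemma euler_form_le k Y v : Y^T = Y ->
  (forall w, `|dot (w *m Y) w| <= 1 / 2 * dot w w) ->
  dot (v *m euler k Y) v <= dot v v + dot (v *m Y) v + 2 * dot (v *m Y) (v *m Y).
Proof.
move=> sY; have [u [d [uu uY uE _ _]]] := spectral_basis sY; move=> hY.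
rewrite (form_eigen _ uu (fun i => euler_eigen k (uY i)) uE) (form_eigen _ uu uY uE).
have -> : dot (v *m Y) (v *m Y) = dot (v *m (Y *m Y)) v.
  by rewrite [RHS]dotC mulmxA [LHS]dot_mulmxl sY dotC.
have uYY i : u i *m (Y *m Y) = d i ^+ 2 *: u i.
  by rewrite mulmxA uY -scalemxAl uY scalerA expr2.
rewrite (form_eigen _ uu uYY uE) (dotvv_basis _ uE) mulr_sumr -!big_split /=.
apply: ler_sum => i _; set c := dot v (u i) ^+ 2.
rewrite [X in _ <= X](_ : _ = (1 + d i + 2 * d i ^+ 2) * c); last by ring.
apply: ler_wpM2r; first exact: sqr_ge0.
have di : `|d i| <= 1 / 2 by have := hY (u i); rewrite uY dotZl uu eqxx !mulr1.
have N1 : (0 < 2 ^ k)%N by rewrite expn_gt0.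
have N2 : 1 <= (2 ^ k)%N%:R :> F by rewrite ler1n.
apply: (@le_trans _ _ (expR (d i))).
  by apply: euler_le_expR => //; have := ler_norml (d i) (1/2); rewrite di => /esym/andP[]; lra.
by apply: expR_le_quadratic; apply: le_trans (ler_norm _) di.
Qed.

(** Some eigenvalue of [S] is at least [a], and the other terms of the trace are nonnegative. The
    loss of a factor 2 in the exponent comes from [expR (y / 2) <= 1 + y] on [[0, 1]], applied to
    [y = a / 2^k]; this holds at finite [k], without passing to the limit. *)
Lemma euler_trace_ge k S v a : (0 < k)%N -> S^T = S -> v != 0 ->
  a * dot v v <= dot (v *m S) v -> 0 <= a <= (2 ^ k)%N%:R ->
  expR (a / 2) <= \tr (euler k S).
Proof.
move=> k0 /spectral_basis[u [d [uu uS uE _ trE]]] v0 av /andP[a0 aN].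
(* If every [d i] were below [a], the lower bound on the form would be an equality and every
   coordinate of [v] would vanish. *)
have [i ai] : exists i, a <= d i.
  apply/not_existsP => h; have := dotvv_gt0 v0.
  have : dot (v *m S) v <= a * dot v v.
    rewrite (form_eigen _ uu uS uE) (dotvv_basis _ uE) mulr_sumr; apply: ler_sum => i _.
    by rewrite ler_wpM2r ?sqr_ge0 // leNgt; apply/negP => /ltW /h.
  move=> h1; have h2 : \sum_i (a - d i) * dot v (u i) ^+ 2 = 0.
    apply/eqP; rewrite eq_le; apply/andP; split; last first.
      apply: sumr_ge0 => i _; rewrite mulr_ge0 ?sqr_ge0 // subr_ge0 leNgt.
      by apply/negP => /ltW /h.
    rewrite (eq_bigr (fun i => a * dot v (u i) ^+ 2 - d i * dot v (u i) ^+ 2)); last first.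
      by move=> i _; rewrite mulrBl.
    by rewrite big_split /= sumrN -mulr_sumr -(dotvv_basis _ uE) -(form_eigen _ uu uS uE) subr_le0.
  have h3 i : dot v (u i) ^+ 2 = 0.
    move/eqP: h2; rewrite psumr_eq0 => [/allP/(_ i (mem_index_enum _))/=|j _].
      rewrite mulf_eq0 subr_eq0 => /orP[/eqP e|/eqP //].
      by case: (h i); rewrite e.
    by rewrite mulr_ge0 ?sqr_ge0 // subr_ge0 leNgt; apply/negP => /ltW /h.
  by rewrite (dotvv_basis _ uE) big1 ?ltxx.
have Np : 0 < (2 ^ k)%N%:R :> F by rewrite ltr0n expn_gt0.
rewrite trE (bigD1 i) //= (euler_eigen k (uS i)) dotZl uu eqxx mulr1.
apply: ler_wpDr.
  by apply: sumr_ge0 => j _; rewrite (euler_eigen k (uS j)) dotZl uu eqxx mulr1 euler_coef_ge0.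
have -> : a / 2 = (2 ^ k)%N%:R * ((2 ^ k)%N%:R^-1 * a / 2).
  by rewrite -!mulrA mulVKf ?gt_eqF.
rewrite expRM_natl; apply: lerXn2r; rewrite ?nnegrE ?expR_ge0 //.
  by rewrite addr_ge0 // mulr_ge0 ?invr_ge0 ?(ltW Np) // (le_trans a0).
apply: (@le_trans _ _ (1 + (2 ^ k)%N%:R^-1 * a)).
  by apply: expR_half_le; rewrite mulr_ge0 ?invr_ge0 ?(ltW Np) //= mulrC ler_pdivrMr ?mul1r.
by rewrite lerD2l ler_wpM2l ?invr_ge0 ?(ltW Np).
Qed.

(** Golden-Thompson detaches [X i] from [S]. The average over [i] is then linear in [euler k (X i)],
    the averaged matrix is at most [rho] as a quadratic form, and positivity of [euler k S] lets
    [rho] leave the trace. *)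
Lemma euler_step (I : finType) (q : I -> F) (X : I -> 'M[F]_n) rho a b k S :
  (0 < k)%N -> S^T = S -> 0 <= a -> 0 <= b -> rowbound S a ->
  (forall i, rowbound (X i) b) ->
  (forall i, 0 <= q i) -> \sum_i q i = 1 -> (forall i, (X i)^T = X i) ->
  (forall i v, `|dot (v *m X i) v| <= 1 / 2 * dot v v) ->
  (forall v, \sum_i q i * (dot (v *m X i) v + 2 * dot (v *m X i) (v *m X i)) <=
     (rho - 1) * dot v v) ->
  \sum_i q i * \tr (euler k (S + X i)) <=
    rho * \tr (euler k S) + n%:R * (a * b * expR (a + b)) * (2 ^ k)%N%:R^-1.
Proof.
move=> k0 sS a0 b0 Sa Xb q0 q1 sX X2 Xr.
set C := _ * (2 ^ k)%N%:R^-1.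
apply: (@le_trans _ _ (\sum_i q i * (\tr (euler k S * euler k (X i)) + C))).
  apply: ler_sum => i _; apply: ler_wpM2l => //.
  by apply: golden_thompson_euler.
under eq_bigr do rewrite mulrDr.
rewrite big_split /= -mulr_suml q1 mul1r lerD2r.
have -> : \sum_i q i * \tr (euler k S * euler k (X i)) =
    \tr (euler k S * \sum_i q i *: euler k (X i)).
  rewrite mulr_sumr raddf_sum; apply: eq_bigr => i _ /=.
  by rewrite -mulmxE -scalemxAr mxtraceZ.
apply: euler_trace_mul_le => // v.
rewrite mulmx_sumr dot_suml.
apply: (@le_trans _ _ (\sum_i q i * (dot v v + (dot (v *m X i) v + 2 * dot (v *m X i) (v *m X i))))).
  apply: ler_sum => i _; rewrite -scalemxAr dotZl; apply: ler_wpM2l => //.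
  by rewrite addrA; apply: euler_form_le.
under eq_bigr do rewrite mulrDr.
by rewrite big_split /= -mulr_suml q1 -lerBrDl -mulrBl.
Qed.

End EulerPotential.

Section SkeletonChain.
Context {F : realType} {n : nat} {T : finType}.
Variables (A B : T -> T -> F) (X : T -> T -> 'M[F]_n).

(* Expected value of [phi (S + sum of J increments)] when the increments [X y z]
   are read off a chain started at [x] and moving alternately by [A] and [B]. *)
Fixpoint skel (phi : 'M[F]_n -> F) J (S : 'M[F]_n) (x : T) : F :=
  if J is J'.+1 then \sum_y A x y * \sum_z B y z * skel phi J' (S + X y z) z else phi S.

Hypothesis A_ge0 : forall x y, 0 <= A x y.
Hypothesis B_ge0 : forall x y, 0 <= B x y.
Hypothesis A_sum : forall x, \sum_y A x y = 1.
Hypothesis B_sum : forall x, \sum_y B x y = 1.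
Hypothesis X_sym : forall y z, (X y z)^T = X y z.

Lemma skel_pair phi J S x : skel phi J.+1 S x =
  \sum_p A x p.1 * B p.1 p.2 * skel phi J (S + X p.1 p.2) p.2.
Proof.
rewrite /= -(pair_bigA _ (fun y z => A x y * B y z * skel phi J (S + X y z) z)) /=.
by apply: eq_bigr => y _; rewrite mulr_sumr; apply: eq_bigr => z _; rewrite mulrA.
Qed.

Lemma skel_weight_sum x : \sum_p A x p.1 * B p.1 p.2 = 1.
Proof.
rewrite -(pair_bigA _ (fun y z => A x y * B y z)) /= -(A_sum x).
by apply: eq_bigr => y _; rewrite -mulr_sumr B_sum mulr1.
Qed.

Lemma skel_le phi psi J S x : S^T = S -> (forall S, S^T = S -> phi S <= psi S) ->
  skel phi J S x <= skel psi J S x.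
Proof.
move=> sS h; elim: J S x sS => [|J IH] S x sS /=; first exact: h.
apply: ler_sum => y _; apply: ler_wpM2l => //.
apply: ler_sum => z _; apply: ler_wpM2l => //; apply: IH.
by rewrite linearD /= sS X_sym.
Qed.

Lemma skelZ c phi J S x : skel (fun S => c * phi S) J S x = c * skel phi J S x.
Proof.
elim: J S x => [|J IH] S x //=.
rewrite mulr_sumr; apply: eq_bigr => y _; rewrite mulrCA; congr (_ * _).
by rewrite mulr_sumr; apply: eq_bigr => z _; rewrite IH mulrCA.
Qed.

Variable rho : F.
Hypothesis rho_ge0 : 0 <= rho.
Hypothesis X_half : forall y z v, `|dot (v *m X y z) v| <= 1 / 2 * dot v v.
Hypothesis X_mgf : forall x v,
  \sum_p A x p.1 * B p.1 p.2 *
    (dot (v *m X p.1 p.2) v + 2 * dot (v *m X p.1 p.2) (v *m X p.1 p.2)) <= (rho - 1) * dot v v.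

(** [C] is chosen before [k], [S] and [x], which is what allows [k] to grow afterwards. This is why
    the induction carries the row bound [c] of the partial sum, enlarged by [b] at each step. *)
Lemma skel_euler_le J c : 0 <= c -> exists2 C, 0 <= C &
  forall k S x, (0 < k)%N -> S^T = S -> rowbound S c ->
    skel (fun S => \tr (euler k S)) J S x <= rho ^+ J * \tr (euler k S) + C * (2 ^ k)%N%:R^-1.
Proof.
have [b b0 Xb] : exists2 b, 0 <= b & forall y z, rowbound (X y z) b.
  pose f (p : T * T) : F := s2val (cid2 (rowbound_exists (X p.1 p.2))).
  have fP p : 0 <= f p /\ rowbound (X p.1 p.2) (f p) by rewrite /f; case: cid2.
  have f0 p := proj1 (fP p).
  exists (\sum_p f p); first exact: sumr_ge0.
  move=> y z; apply: (@rowboundW _ _ _ (f (y, z))); last exact: (proj2 (fP (y, z))).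
  by rewrite (bigD1 (y, z)) //= lerDl sumr_ge0.
elim: J c => [|J IH] c c0.
  by exists 0 => // k S x _ _ _; rewrite expr0 mul1r mul0r addr0.
have [C C0 hC] := IH (c + b) (addr_ge0 c0 b0).
have n0 : 0 <= n%:R * (c * b * expR (c + b)) by rewrite !mulr_ge0 ?expR_ge0.
exists (rho ^+ J * (n%:R * (c * b * expR (c + b))) + C).
  by rewrite addr_ge0 // mulr_ge0 ?exprn_ge0.
move=> k S x k0 sS Sc; rewrite skel_pair.
have N0 : 0 <= (2 ^ k)%N%:R^-1 :> F by rewrite invr_ge0.
apply: (@le_trans _ _ (\sum_p A x p.1 * B p.1 p.2 *
    (rho ^+ J * \tr (euler k (S + X p.1 p.2)) + C * (2 ^ k)%N%:R^-1))).
  apply: ler_sum => p _; apply: ler_wpM2l; first exact: mulr_ge0.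
  by apply: hC => //; [rewrite linearD /= sS X_sym|apply: rowboundD].
under eq_bigr do rewrite mulrDr mulrCA.
rewrite big_split /= -mulr_sumr -mulr_suml skel_weight_sum mul1r.
have w0 p : 0 <= A x p.1 * B p.1 p.2 by apply: mulr_ge0.
have st := @euler_step _ _ (T * T)%type (fun p => A x p.1 * B p.1 p.2) (fun p => X p.1 p.2)
  rho c b k S k0 sS c0 b0 Sc (fun p => Xb _ _) w0 (skel_weight_sum x) (fun p => X_sym _ _)
  (fun p => X_half _ _) (X_mgf x).
have := ler_wpM2l (exprn_ge0 J rho_ge0) st.
set t := \tr _; set D := n%:R * _; set N := _^-1; set s := \sum_p _ => h.
rewrite [X in _ <= X](_ : _ = rho ^+ J * (rho * t + D * N) + C * N); last by rewrite exprS; ring.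
by rewrite lerD2r.
Qed.

(** For symmetric [S], the condition that the largest eigenvalue is at least [a], in Rayleigh
    quotient form. *)
Definition top_form_ge a (S : 'M[F]_n) : Prop :=
  exists2 v, v != 0 & a * dot v v <= dot (v *m S) v.

(** Markov's inequality for the trace of the approximate exponential, started at [S = 0] where this
    trace is [n]. For any slack [e], a large enough [k] brings the accumulated error below [e] and
    makes [a <= 2^k]. *)
Theorem skel_tail J a x : 0 <= a ->
  skel (fun S => `[< top_form_ge a S >]%:R) J 0 x <= n%:R * rho ^+ J * expR (- (a / 2)).
Proof.
move=> a0; have [C C0 hC] := skel_euler_le J (lexx 0).
rewrite exp.expRN ler_pdivlMr ?expR_gt0 // mulrC -skelZ.
apply/ler_addgt0Pr => e e0.
have [k [k0 ak Ck]] : exists k, [/\ (0 < k)%N, a <= (2 ^ k)%N%:R & C * (2 ^ k)%N%:R^-1 <= e].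
  pose m := (Num.bound (Num.max a (C / e))).
  have hm : Num.max a (C / e) <= m%:R by apply: ltW; apply: archi_boundP; rewrite le_max a0.
  have hmN : m%:R <= (2 ^ m.+1)%N%:R :> F.
    by rewrite ler_nat; apply: (leq_trans (ltnW (ltn_expl m (ltnSn 1)))); rewrite leq_exp2l.
  exists m.+1; split => //; first by apply: le_trans hmN; apply: le_trans hm; rewrite le_max lexx.
  rewrite ler_pdivrMr ?ltr0n ?expn_gt0 // mulrC -ler_pdivrMr //.
  by apply: le_trans hmN; apply: le_trans hm; rewrite le_max lexx orbT.
apply: (le_trans _ (le_trans (hC k 0 x k0 (trmx0 _ _ _) _) _)).
- apply: skel_le; first exact: trmx0.
  move=> S sS; case: asboolP => [[v v0 hv]|_]; last first.
    rewrite mulr0 -[\tr _]mul1r -[1 in X in _ <= X * _]opprK.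
    have [u [d [uu uS _ _ trE]]] := spectral_basis sS.
    rewrite opprK mul1r trE sumr_ge0 // => i _.
    by rewrite (euler_eigen k (uS i)) dotZl mulr_ge0 ?euler_coef_ge0 ?dotvv_ge0.
  by rewrite mulr1; apply: euler_trace_ge hv _; rewrite ?a0.
- by move=> i; rewrite big1 // => j _; rewrite mxE normr0.
- by rewrite euler0 mxtrace1 mulrC lerD2l.
Qed.

End SkeletonChain.

(** * Trajectories *)

Section PathExpectation.
Context {n : nat}.
Variable P : 'M[R]_n.
Implicit Types (x y : 'I_n) (f h : seq 'I_n -> R).

(* Expected value of [f] on the trajectory of [l.+1] states started at [x]. *)
Fixpoint traj l x f : R :=
  if l is l'.+1 then \sum_y P x y * traj l' y (fun s => f (x :: s)) else f [:: x].

Lemma eq_traj l x f h : (forall s, size s = l -> f (x :: s) = h (x :: s)) ->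
  traj l x f = traj l x h.
Proof.
elim: l x f h => [|l IH] x f h fh /=; first exact: fh.
apply: eq_bigr => y _; congr (_ * _); apply: IH => s ss.
by apply: fh; rewrite /= ss.
Qed.

(* Chapman-Kolmogorov. *)
Lemma traj_drop g l x h :
  traj (g + l) x (fun s => h (drop g s)) = \sum_y (P ^+ g) x y * traj l y h.
Proof.
elim: g x => [|g IH] x.
  rewrite add0n expr0 (bigD1 x) //= big1 => [|y yx]; rewrite mxE ?eqxx ?mul1r ?addr0.
    by apply: eq_traj => s _; rewrite drop0.
  by rewrite eq_sym (negbTE yx) mul0r.
rewrite addSn /=; under eq_bigr do rewrite IH.
under [RHS]eq_bigr => y _ do rewrite exprS -mulmxE mxE mulr_suml.
rewrite [RHS]exchange_big /=; apply: eq_bigr => y _; rewrite mulr_sumr.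
by apply: eq_bigr => z _; rewrite mulrA.
Qed.

Hypothesis hP : row_stochastic P.

Lemma traj_cst l x c : traj l x (fun=> c) = c.
Proof.
elim: l x => [|l IH] x //=; under eq_bigr do rewrite IH.
by rewrite -mulr_suml (proj2 hP) mul1r.
Qed.

Lemma row_stochasticX g : row_stochastic (P ^+ g).
Proof.
have [P0 P1] := hP; elim: g => [|g [IH0 IH1]]; split=> x.
- by move=> y; rewrite expr0 mxE; case: eqP.
- rewrite expr0 (bigD1 x) //= big1 => [|y yx]; rewrite mxE ?eqxx ?addr0 //.
  by rewrite eq_sym (negbTE yx).
- move=> y; rewrite exprS -mulmxE mxE sumr_ge0 // => z _.
  by rewrite mulr_ge0.
- rewrite exprS; under eq_bigr do rewrite -mulmxE mxE.
  rewrite exchange_big /=; under eq_bigr do rewrite -mulr_sumr IH1 mulr1.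
  exact: P1.
Qed.

Variables (d : nat) (X : 'I_n -> 'I_n -> 'M[R]_d) (x0 : 'I_n) (g k : nat).

Definition skip_sum J (p : seq 'I_n) : 'M[R]_d :=
  \sum_(j < J) X (nth x0 p (g + j * (g + k))) (nth x0 p (g + j * (g + k) + k)).

Lemma skip_sumS J p : skip_sum J.+1 p =
  X (nth x0 (drop g p) 0) (nth x0 (drop k (drop g p)) 0) + skip_sum J (drop k (drop g p)).
Proof.
rewrite /skip_sum big_ord_recl; congr (_ + _).
  by rewrite !nth_drop; congr (X (nth _ _ _) (nth _ _ _)); rewrite /=; lia.
apply: eq_bigr => j _; rewrite !nth_drop lift0.
by congr (X (nth _ _ _) (nth _ _ _)); lia.
Qed.

(** Each increment uses two applications of Chapman-Kolmogorov, over the gap [g] and then over the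
    skip [k]. States after the last sample integrate to 1, so [l] may exceed the length of the [J]
    blocks. *)
Lemma traj_skel phi J l S x : (J * (g + k) <= l)%N ->
  traj l x (fun p => phi (S + skip_sum J p)) =
  skel (fun y z => (P ^+ g) y z) (fun y z => (P ^+ k) y z) X phi J S x.
Proof.
elim: J l S x => [|J IH] l S x Jl.
  rewrite -[RHS](traj_cst l x); apply: eq_traj => s _ /=.
  by rewrite /skip_sum big_ord0 addr0.
have lE : l = (g + (k + (l - (g + k))))%N by lia.
set l' := (l - (g + k))%N in lE; have Jl' : (J * (g + k) <= l')%N by rewrite /l'; lia.
clearbody l'; rewrite {}lE {l Jl}.
pose H q := phi (S + X (nth x0 q 0) (nth x0 (drop k q) 0) + skip_sum J (drop k q)).
rewrite (@eq_traj _ _ _ (fun p => H (drop g p))); last first.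
  by move=> s _; rewrite skip_sumS addrA.
rewrite traj_drop /=; apply: eq_bigr => y _; congr (_ * _).
pose H' q := phi (S + X y (nth x0 q 0) + skip_sum J q).
rewrite (@eq_traj _ _ _ (fun p => H' (drop k p))) // traj_drop.
apply: eq_bigr => z _; congr (_ * _); rewrite -(IH _ _ _ Jl').
by apply: eq_traj.
Qed.

End PathExpectation.

Section PathProbability.
Context {n : nat}.
Variable P : 'M[R]_n.

Definition cons_path m (x : 'I_n) (w : cpath n m) : cpath n m.+1 :=
  [ffun i => if unlift ord0 i is Some j then w j else x].

Lemma Xopt_ord m (w : cpath n m) (i : 'I_m) : Xopt w i = Some (w i).
Proof. by rewrite /Xopt valK. Qed.

Lemma Xopt_cons0 m x (w : cpath n m) : Xopt (cons_path x w) 0 = Some x.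
Proof. by rewrite (Xopt_ord (cons_path x w) ord0) ffunE unlift_none. Qed.

Lemma Xopt_consS m x (w : cpath n m) t : Xopt (cons_path x w) t.+1 = Xopt w t.
Proof.
have [tm|tm] := ltnP t m; last by rewrite /Xopt !insubF //; apply/negbTE; rewrite -leqNgt.
have e : t.+1 = lift ord0 (Ordinal tm) by [].
by rewrite e (Xopt_ord (cons_path x w)) ffunE liftK -(Xopt_ord w).
Qed.

Lemma codom_cons m x (w : cpath n m) : codom (cons_path x w) = x :: codom w.
Proof.
rewrite !codomE enum_ordSl /= ffunE unlift_none -map_comp; congr (_ :: _).
by apply: eq_map => i /=; rewrite ffunE liftK.
Qed.

Lemma sum_cons_path m (f : cpath n m.+1 -> R) : \sum_w f w = \sum_x \sum_w f (cons_path x w).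
Proof.
rewrite pair_bigA /= (reindex (fun p : 'I_n * cpath n m => cons_path p.1 p.2)) //=.
exists (fun w : cpath n m.+1 => (w ord0, [ffun j => w (lift ord0 j)])) => [[x w]|w] _ /=.
  by rewrite ffunE unlift_none; congr (_, _); apply/ffunP => j; rewrite !ffunE liftK.
apply/ffunP => i; rewrite ffunE; case: unliftP => [j|] ->; by rewrite ?ffunE.
Qed.

Lemma path_prob_cons m mu x (w : cpath n m.+1) :
  path_prob mu P (cons_path x w) = mu 0 x * path_prob (row x P) P w.
Proof.
rewrite /path_prob Xopt_cons0 /=; congr (_ * _).
rewrite big_ord_recl Xopt_cons0 Xopt_consS; congr (_ * _).
  rewrite (Xopt_ord w ord0) /= mxE //.
by apply: eq_bigr => t _; rewrite lift0 !Xopt_consS.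
Qed.

(** Passage from the sum over finite functions to the recursive expectation, where the Markov
    property holds by computation. *)
Lemma sum_path_prob m mu (f : seq 'I_n -> R) :
  \sum_(w : cpath n m.+1) path_prob mu P w * f (codom w) = \sum_x mu 0 x * traj P m x f.
Proof.
elim: m mu f => [|m IH] mu f; rewrite sum_cons_path; apply: eq_bigr => x _.
  have w0 : cpath n 0 := [ffun i : 'I_0 => x].
  have e (w : cpath n 0) : w = w0 by apply/ffunP; case.
  rewrite (bigD1 w0) //= big1 => [|w]; last by rewrite (e w) eqxx.
  rewrite addr0 codom_cons /path_prob Xopt_cons0 big_ord0 mulr1; congr (_ * f _).
  by rewrite codomE /=; congr (_ :: _); apply: size0nil; rewrite size_map size_enum_ord.
under eq_bigr do rewrite path_prob_cons codom_cons -mulrA.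
rewrite -mulr_sumr (IH (row x P) (fun s => f (x :: s))) /=; congr (_ * _).
by apply: eq_bigr => y _; rewrite mxE.
Qed.

Lemma Xopt_codom m (w : cpath n m) x0 t : (t < m)%N -> Xopt w t = Some (nth x0 (codom w) t).
Proof.
move=> tm; rewrite (Xopt_ord w (Ordinal tm)) codomE (nth_map (Ordinal tm)) ?size_enum_ord //.
by congr (Some (w _)); apply: val_inj; rewrite /= nth_enum_ord.
Qed.

Hypothesis hP : row_stochastic P.
Variable mu : 'rV[R]_n.
Hypothesis hmu : is_distribution mu.

Lemma path_prob_ge0 m (w : cpath n m) : 0 <= path_prob mu P w.
Proof.
rewrite /path_prob mulr_ge0 //; first by case: Xopt => // x; exact: (proj1 hmu).
apply: prodr_ge0 => t _; rewrite /Popt.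
by case: (Xopt w t) => // x; case: (Xopt w _) => // y; exact: (proj1 hP).
Qed.

Lemma sum_path_prob1 m : \sum_(w : cpath n m.+1) path_prob mu P w = 1.
Proof.
under eq_bigr do rewrite -[path_prob _ _ _]mulr1.
rewrite (sum_path_prob m mu (fun=> 1)); under eq_bigr do rewrite traj_cst // mulr1.
exact: (proj2 hmu).
Qed.

Lemma prob_le m (E E' : pred (cpath n m)) : {subset E <= E'} -> prob mu P E <= prob mu P E'.
Proof.
move=> EE; rewrite /prob [X in X <= _]big_mkcond [X in _ <= X]big_mkcond /=.
apply: ler_sum => w _; case: ifP => [/EE|_]; first by rewrite unfold_in => ->.
by case: ifP => // _; exact: path_prob_ge0.
Qed.

Lemma prob_setC m (E : pred (cpath n m.+1)) : prob mu P E = 1 - prob mu P (predC E).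
Proof. by rewrite -(sum_path_prob1 m) (bigID E) /= /prob addrK. Qed.

Lemma prob_has m (I : eqType) (r : seq I) (E : I -> pred (cpath n m)) :
  prob mu P (fun w => has (fun i => E i w) r) <= \sum_(i <- r) prob mu P (E i).
Proof.
elim: r => [|i r IH]; first by rewrite big_nil /prob big_pred0.
rewrite big_cons; apply: le_trans (lerD (lexx _) IH).
rewrite /prob [X in X <= _]big_mkcond [X in _ <= X + _]big_mkcond [X in _ <= _ + X]big_mkcond /=.
rewrite -big_split /=; apply: ler_sum => w _; have := path_prob_ge0 w.
by case: (E i w) => /=; case: has => h; lra.
Qed.

Lemma prob_traj m (f : pred (seq 'I_n)) :
  prob mu P (fun w : cpath n m.+1 => f (codom w)) =
  \sum_x mu 0 x * traj P m x (fun s => (f s)%:R).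
Proof.
rewrite -sum_path_prob /prob big_mkcond /=; apply: eq_bigr => w _.
by case: (f _); rewrite ?mulr1 ?mulr0.
Qed.

End PathProbability.

(** * Symmetrization and mixing *)

(** The weights are not normalized: below they are what remains of a stochastic row after a multiple
    of [pi] is removed, with total mass [1 - eta]. *)
Lemma weighted_jensen {F : rcfType} n (q a : 'I_n -> F) : (forall i, 0 <= q i) ->
  (\sum_i q i * a i) ^+ 2 <= (\sum_i q i) * \sum_i q i * a i ^+ 2.
Proof.
move=> q0; have := cauchy_schwarz (\row_i Num.sqrt (q i)) (\row_i (Num.sqrt (q i) * a i)).
rewrite !dotE; congr (_ ^+ 2 <= _ * _); apply: eq_bigr => i _; rewrite !mxE.
- by rewrite mulrA -expr2 sqr_sqrtr.
- by rewrite -expr2 sqr_sqrtr.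
- by rewrite mulrACA -!expr2 sqr_sqrtr.
Qed.

Section Symmetrization.
Context {n : nat}.
Variable pi : 'rV[R]_n.
Hypothesis pi_gt0 : forall x, 0 < pi 0 x.
Hypothesis pi_sum : \sum_x pi 0 x = 1.

Definition sqrt_row : 'rV[R]_n := \row_x Num.sqrt (pi 0 x).

(* D^{1/2} Q D^{-1/2} for D the diagonal matrix of [pi]. *)
Definition symmetrize (Q : 'M[R]_n) : 'M[R]_n :=
  \matrix_(x, y) (sqrt_row 0 x * Q x y / sqrt_row 0 y).

Lemma sqrt_row_gt0 x : 0 < sqrt_row 0 x.
Proof. by rewrite mxE sqrtr_gt0. Qed.

Lemma sqrt_row_sqr x : sqrt_row 0 x ^+ 2 = pi 0 x.
Proof. by rewrite mxE sqr_sqrtr // ltW. Qed.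

Lemma dot_sqrt_row : dot sqrt_row sqrt_row = 1.
Proof. by rewrite dotE -pi_sum; apply: eq_bigr => x _; rewrite -expr2 sqrt_row_sqr. Qed.

Let s0 x : sqrt_row 0 x != 0.
Proof. by rewrite gt_eqF ?sqrt_row_gt0. Qed.

Lemma symmetrize1 : symmetrize 1 = 1.
Proof.
apply/matrixP => x y; have e : (1 : 'M[R]_n) x y = (x == y)%:R by rewrite mxE.
rewrite [LHS]mxE e; case: eqVneq => [->|_]; first by rewrite mulr1 mulfV.
by rewrite mulr0 mul0r.
Qed.

Lemma symmetrizeM P Q : symmetrize (P * Q) = symmetrize P * symmetrize Q.
Proof.
apply/matrixP => x y; rewrite -!mulmxE [LHS]mxE [RHS]mxE [X in _ * X / _]mxE.
rewrite mulr_sumr mulr_suml; apply: eq_bigr => z _.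
by rewrite [symmetrize P x z]mxE [symmetrize Q z y]mxE; field; rewrite !s0.
Qed.

Lemma symmetrizeX P k : symmetrize (P ^+ k) = symmetrize P ^+ k.
Proof. by elim: k => [|k IH]; rewrite ?symmetrize1 // !exprS symmetrizeM IH. Qed.

(** The two matrices are conjugate by the diagonal of [sqrt_row]. Since [lambda2] depends on a
    matrix only through its characteristic polynomial, this suffices although the left one is not
    symmetric. *)
Lemma gamma_dagger_symmetrize Q :
  gamma_dagger pi Q = 1 - lambda2 ((symmetrize Q)^T *m symmetrize Q).
Proof.
rewrite /gamma_dagger /gamma_mx /lambda2; congr (1 - nth 0 (epsilon _ _) 1).
suff h : char_poly (reversal pi Q *m Q) = char_poly ((symmetrize Q)^T *m symmetrize Q).
  by rewrite /eigs_desc h.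
pose D := diag_mx sqrt_row; pose D' := diag_mx (\row_x (sqrt_row 0 x)^-1).
have DD : D *m D' = 1%:M.
  apply/matrixP => x y; rewrite mul_diag_mx !mxE; case: eqVneq => [->|_].
    by have := s0 y; rewrite mxE => ?; rewrite mulr1n mulfV.
  by rewrite mulr0n mulr0.
rewrite -(char_poly_conj _ DD); congr char_poly; apply/matrixP => x y.
rewrite mul_mx_diag mxE mul_diag_mx mxE [X in _ * X * _]mxE [RHS]mxE mulr_sumr mulr_suml.
apply: eq_bigr => z _; rewrite [reversal pi Q x z]mxE [(symmetrize Q)^T x z]mxE.
rewrite [symmetrize Q z x]mxE [symmetrize Q z y]mxE [(\row_x _) 0 y]mxE -!sqrt_row_sqr.
by field; rewrite !s0.
Qed.


Definition preserves (Q : 'M[R]_n) := row_stochastic Q /\ pi *m Q = pi.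

Lemma preservesX P k : preserves P -> preserves (P ^+ k).
Proof.
move=> [sP piP]; split; first exact: row_stochasticX.
elim: k => [|k IH]; first by rewrite expr0 mulmx1.
by rewrite exprS -mulmxE mulmxA piP.
Qed.

Section Contraction.
Variable Q : 'M[R]_n.
Hypothesis hQ : preserves Q.

Lemma mulmx_symmetrize_tr (v : 'rV[R]_n) x : (v *m (symmetrize Q)^T) 0 x =
  sqrt_row 0 x * \sum_y Q x y * (v 0 y / sqrt_row 0 y).
Proof.
rewrite mxE mulr_sumr; apply: eq_bigr => y _.
by rewrite [(symmetrize Q)^T y x]mxE [symmetrize Q x y]mxE; field; rewrite !s0.
Qed.

Lemma sqrt_row_symmetrize_tr : sqrt_row *m (symmetrize Q)^T = sqrt_row.
Proof.
apply/rowP => x; rewrite mulmx_symmetrize_tr -[RHS]mulr1 -(proj2 (proj1 hQ) x).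
by congr (_ * _); apply: eq_bigr => y _; rewrite divff ?mulr1.
Qed.

Lemma sqrt_row_symmetrize : sqrt_row *m symmetrize Q = sqrt_row.
Proof.
apply/rowP => y; have := proj2 hQ => /rowP/(_ y); rewrite [LHS]mxE => h.
rewrite [LHS]mxE.
transitivity ((\sum_x pi 0 x * Q x y) / sqrt_row 0 y).
  rewrite mulr_suml; apply: eq_bigr => x _.
  by rewrite [symmetrize Q x y]mxE -sqrt_row_sqr; field; rewrite !s0.
by rewrite h -sqrt_row_sqr expr2 mulfK.
Qed.

Lemma dot_symmetrize_tr_sqrt_row v :
  dot (v *m (symmetrize Q)^T) sqrt_row = dot v sqrt_row.
Proof. by rewrite dot_mulmxl trmxK sqrt_row_symmetrize. Qed.

(* Doeblin: the part [eta * pi] common to all rows of [Q] does not act on mean-zero vectors. *)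
Lemma symmetrize_contraction eta v : 0 <= eta -> (forall x y, eta * pi 0 y <= Q x y) ->
  eta * dot v sqrt_row = 0 ->
  dot (v *m (symmetrize Q)^T) (v *m (symmetrize Q)^T) <= (1 - eta) ^+ 2 * dot v v.
Proof.
move=> e0 eQ ev; pose f y := v 0 y / sqrt_row 0 y.
pose Q' x y := Q x y - eta * pi 0 y.
have Q'0 x y : 0 <= Q' x y by rewrite subr_ge0.
have Q'1 x : \sum_y Q' x y = 1 - eta.
  by rewrite big_split /= sumrN -mulr_sumr pi_sum mulr1 (proj2 (proj1 hQ)).
have pif : eta * \sum_y pi 0 y * f y = 0.
  rewrite -[RHS]ev dotE; congr (_ * _); apply: eq_bigr => y _.
  by rewrite -sqrt_row_sqr /f; field; rewrite s0.
have Qf x : \sum_y Q x y * f y = \sum_y Q' x y * f y.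
  rewrite [RHS](eq_bigr (fun y => Q x y * f y - eta * (pi 0 y * f y))) => [|y _].
    by rewrite big_split /= sumrN -mulr_sumr pif subr0.
  by rewrite /Q'; ring.
have piQ' y : \sum_x pi 0 x * Q' x y = (1 - eta) * pi 0 y.
  under eq_bigr do rewrite mulrBr.
  rewrite big_split /= sumrN -mulr_suml pi_sum mul1r mulrBl mul1r; congr (_ - _).
  by have := proj2 hQ => /rowP/(_ y); rewrite mxE.
rewrite dotE.
under eq_bigr do rewrite -expr2 mulmx_symmetrize_tr exprMn sqrt_row_sqr -/(f _) Qf.
(* One factor [1 - eta] comes from the row masses by Jensen, the other from the invariance of [pi]
   ([piQ']). *)
apply: (@le_trans _ _ (\sum_x pi 0 x * ((1 - eta) * \sum_y Q' x y * f y ^+ 2))).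
  apply: ler_sum => x _; apply: ler_wpM2l; first exact: ltW.
  by rewrite -(Q'1 x); apply: weighted_jensen.
under eq_bigr do rewrite mulrCA mulr_sumr.
rewrite -mulr_sumr exchange_big /= expr2 -mulrA dotE.
apply: ler_wpM2l.
  have [x _] : exists x : 'I_n, True.
    apply/not_existsP => h; have : \sum_x pi 0 x = 0 by rewrite big1 // => x; case: (h x).
    by rewrite pi_sum => /eqP; rewrite oner_eq0.
  by rewrite -(Q'1 x) sumr_ge0.
rewrite mulr_sumr le_eqVlt; apply/orP; left; apply/eqP; apply: eq_bigr => y _.
under eq_bigr do rewrite mulrA.
by rewrite -mulr_suml piQ' -sqrt_row_sqr /f; field; rewrite s0.
Qed.

(** The contraction lemma at [eta = 0]: its orthogonality hypothesis carries the factor [eta] so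
    that it becomes vacuous here. *)
Lemma symmetrize_nonexpansive v :
  dot (v *m (symmetrize Q)^T) (v *m (symmetrize Q)^T) <= dot v v.
Proof.
have := @symmetrize_contraction 0 v (lexx 0); rewrite subr0 expr1n mul1r; apply.
  by move=> x y; rewrite mul0r (proj1 (proj1 hQ)).
by rewrite mul0r.
Qed.

Hypothesis n_gt1 : (1 < n)%N.

Let A := (symmetrize Q)^T *m symmetrize Q.

Let sA : A^T = A. Proof. by rewrite /A trmx_mul trmxK. Qed.

Lemma gram_form v : dot (v *m A) v = dot (v *m (symmetrize Q)^T) (v *m (symmetrize Q)^T).
Proof. by rewrite /A mulmxA [LHS]dot_mulmxl. Qed.

Lemma gamma_dagger_ge0 : 0 <= gamma_dagger pi Q.
Proof.
rewrite gamma_dagger_symmetrize subr_ge0; apply: lambda2_le1 => // v.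
by rewrite gram_form symmetrize_nonexpansive.
Qed.

Lemma gamma_dagger_le1 : gamma_dagger pi Q <= 1.
Proof.
rewrite gamma_dagger_symmetrize lerBlDl lerDr; apply: lambda2_ge0 => // v.
by rewrite gram_form dotvv_ge0.
Qed.

(** [sqrt_row] is fixed by [symmetrize Q] and by its transpose, hence is an eigenvector of the Gram
    matrix for its largest eigenvalue 1. *)
Lemma gamma_dagger_contraction v : dot v sqrt_row = 0 ->
  dot (v *m (symmetrize Q)^T) (v *m (symmetrize Q)^T) <= (1 - gamma_dagger pi Q) * dot v v.
Proof.
move=> vs; rewrite gamma_dagger_symmetrize opprB addrC subrK -gram_form.
apply: (lambda2_ge_complement n_gt1 sA _ dot_sqrt_row) => //.
  by rewrite /A mulmxA sqrt_row_symmetrize_tr sqrt_row_symmetrize.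
by move=> w; rewrite gram_form symmetrize_nonexpansive.
Qed.

Lemma gamma_dagger_gt0 : (forall x y, 0 < Q x y) -> 0 < gamma_dagger pi Q.
Proof.
move=> Q0.
(* The default [1 / 2] caps [eta], so that [(1 - eta) ^+ 2 < 1]. *)
pose eta := \big[Num.min/1 / 2]_x \big[Num.min/1 / 2]_y Q x y.
have e0 : 0 < eta by apply: lt_bigmin => [|x _]; [lra|apply: lt_bigmin => //; lra].
have e1 : eta <= 1 / 2 by apply: bigmin_le_id.
have eQ x y : eta * pi 0 y <= Q x y.
  apply: (@le_trans _ _ eta); last by apply: le_trans (bigmin_le _ x _) (bigmin_le _ y _).
  rewrite -[leRHS]mulr1; apply: ler_wpM2l; first exact: ltW.
  rewrite -pi_sum (bigD1 y) //= lerDl.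
  by apply: sumr_ge0 => z _; apply: ltW.
have [v [v0 vs lv]] := lambda2_le_hyperplane n_gt1 sqrt_row sA.
have := @symmetrize_contraction eta v (ltW e0) eQ; rewrite vs mulr0 => /(_ erefl).
rewrite -gram_form => h; rewrite gamma_dagger_symmetrize subr_gt0.
rewrite -(ltr_pM2r (dotvv_gt0 v0)) mul1r; apply: (le_lt_trans (le_trans lv h)).
by rewrite gtr_pMl ?dotvv_gt0 //; nra.
Qed.

End Contraction.

End Symmetrization.

(** * Pseudo-spectral gap and mixing time *)

Section PseudoSpectralGap.
Context {n : nat} (n_gt1 : (1 < n)%N).
Variables (P : 'M[R]_n) (pi : 'rV[R]_n).
Hypothesis sP : row_stochastic P.
Hypothesis primP : primitive P.
Hypothesis statP : stationary P pi.
Hypothesis pi_gt0 : forall x, 0 < pi 0 x.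

Let pi_sum : \sum_x pi 0 x = 1 := proj2 (proj1 statP).
Let hP : preserves pi P := conj sP (proj2 statP).

Lemma pi_star_le x : pi_star pi <= pi 0 x.
Proof. exact: bigmin_le. Qed.

Lemma pi_star_gt0 : 0 < pi_star pi.
Proof. by apply: lt_bigmin. Qed.

Lemma card_pi_star : n%:R * pi_star pi <= 1.
Proof.
rewrite -[leRHS]pi_sum; apply: (@le_trans _ _ (\sum_(x < n) pi_star pi)).
  by rewrite sumr_const card_ord mulr_natl.
by apply: ler_sum => x _; apply: pi_star_le.
Qed.

Lemma pi_star_le_half : pi_star pi <= 1 / 2.
Proof.
have n2 : 2 <= n%:R :> R by rewrite ler_nat.
by have := card_pi_star; have := pi_star_gt0; nra.
Qed.

Let gaps := [set g | exists k : nat, (0 < k)%N /\ g = gamma_dagger pi (P ^+ k) / k%:R]%classic.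

Lemma gamma_dagger_pow_bounds k : 0 <= gamma_dagger pi (P ^+ k) <= 1.
Proof.
have h := preservesX k hP.
by rewrite (gamma_dagger_ge0 pi_gt0 pi_sum h) // (gamma_dagger_le1 pi_gt0).
Qed.

Let ub_gaps : ubound gaps 1.
Proof.
move=> g [k [k0 ->]]; rewrite ler_pdivrMr ?ltr0n // mul1r.
have /andP[_ h] := gamma_dagger_pow_bounds k; apply: le_trans h _.
by rewrite ler1n.
Qed.

Let has_sup_gaps : has_sup gaps.
Proof. by split; [exists (gamma_dagger pi (P ^+ 1) / 1%:R), 1%N|exists 1]. Qed.

Lemma gamma_dagger_le_ps k : (0 < k)%N -> gamma_dagger pi (P ^+ k) / k%:R <= gamma_ps pi P.
Proof. by move=> k0; apply: sup_upper_bound => //; exists k. Qed.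

Lemma gamma_ps_le b : (forall k, (0 < k)%N -> gamma_dagger pi (P ^+ k) / k%:R <= b) ->
  gamma_ps pi P <= b.
Proof.
move=> h; apply: ge_sup; first exact: (proj1 has_sup_gaps).
by move=> g [k [k0 ->]]; apply: h.
Qed.

Lemma gamma_ps_le1 : gamma_ps pi P <= 1.
Proof. by apply: ge_sup; [exact: (proj1 has_sup_gaps)|exact: ub_gaps]. Qed.

Lemma gamma_ps_gt0 : 0 < gamma_ps pi P.
Proof.
have [k [k0 Pk]] := primP; apply: lt_le_trans (gamma_dagger_le_ps k0).
by rewrite divr_gt0 ?ltr0n // gamma_dagger_gt0 //; exact: preservesX.
Qed.

(** Half of the supremum is enough for mixing, so attainment of the maximum need not be
    established. *)
Lemma near_optimal_skip : exists k, (0 < k)%N /\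
  gamma_ps pi P / 2 <= gamma_dagger pi (P ^+ k) / k%:R.
Proof.
have g2 : 0 < gamma_ps pi P / 2 by rewrite divr_gt0 ?gamma_ps_gt0.
have [_ [k [k0 ->]] h] := sup_adherent g2 has_sup_gaps.
exists k; split=> //; move: h; rewrite -/(gamma_ps pi P); lra.
Qed.

Let L := symmetrize pi P.

Let iterN v k : dot v (sqrt_row pi) = 0 -> dot (v *m (L ^+ k)^T) (sqrt_row pi) = 0.
Proof.
move=> vs; rewrite /L -symmetrizeX // dot_symmetrize_tr_sqrt_row //.
exact: preservesX.
Qed.

(** With [k] near-optimal and [b = q k + r], each block of [k] steps contracts by [1 - G], where
    [G >= k gamma_ps / 2], and the last [r] steps do not expand. Replacing [q] by [b / k] loses at
    most one block, and [G <= 1] turns that loss into the constant 1 of the exponent. *)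
Lemma symmetrize_pow_decay b (v : 'rV[R]_n) : dot v (sqrt_row pi) = 0 ->
  dot (v *m (symmetrize pi P ^+ b)^T) (v *m (symmetrize pi P ^+ b)^T) <=
  expR (1 - gamma_ps pi P * b%:R / 2) * dot v v.
Proof.
move=> vs; have [k [k0 gk]] := near_optimal_skip.
set G := gamma_dagger pi (P ^+ k) in gk.
have /andP[G0 G1] := gamma_dagger_pow_bounds k; rewrite -/G in G0 G1.
have iter q : dot (v *m (L ^+ (k * q))^T) (v *m (L ^+ (k * q))^T) <= (1 - G) ^+ q * dot v v.
  elim: q => [|q IH]; first by rewrite muln0 !expr0 trmx1 mulmx1 mul1r.
  rewrite mulnS exprD -mulmxE trmx_mul mulmxA.
  set w := v *m (L ^+ (k * q))^T in IH *.
  have ws : dot w (sqrt_row pi) = 0 by apply: iterN.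
  have := gamma_dagger_contraction pi_gt0 pi_sum (preservesX k hP) n_gt1 ws.
  rewrite symmetrizeX // -/L -/G => h; apply: (le_trans h).
  by rewrite exprS -mulrA ler_wpM2l // subr_ge0.
rewrite -/L {1 2}(divn_eq b k) addnC mulnC exprD -mulmxE trmx_mul mulmxA.
set q := (b %/ k)%N; set w := v *m _.
have := symmetrize_nonexpansive pi_gt0 pi_sum (preservesX (b %% k) hP) w.
rewrite symmetrizeX // -/L => h; apply: (le_trans h); apply: (le_trans (iter q)).
apply: ler_wpM2r; first exact: dotvv_ge0.
apply: (@le_trans _ _ (expR (- G) ^+ q)).
  by apply: lerXn2r; rewrite ?nnegrE ?subr_ge0 ?expR_ge0 ?expR_ge1Dx.
rewrite -expRM_natl ler_expR.
have kp : 0 < k%:R :> R by rewrite ltr0n.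
have bq : b%:R <= k%:R * (q%:R + 1) :> R.
  by rewrite natr1 -natrM ler_nat mulnC ltnW // ltn_ceil.
rewrite ler_pdivlMr // in gk.
have : gamma_ps pi P / 2 * b%:R <= gamma_ps pi P / 2 * (k%:R * (q%:R + 1)).
  by apply: ler_wpM2l bq; rewrite divr_ge0 // ltW ?gamma_ps_gt0.
have : gamma_ps pi P / 2 * k%:R * (q%:R + 1) <= G * (q%:R + 1).
  by apply: ler_wpM2r gk; rewrite addr_ge0.
by rewrite mulrN mulrA; lra.
Qed.

(** The decay is applied to [e_y] minus its projection on [sqrt_row]. Coordinate [x] of the image is
    [s_x (P^b(x,y) - pi_y) / s_y], so the error is at most [E pi_y / (s_x s_y)], and
    [s_x s_y >= pi_star]. *)
Lemma mixing b x y : `|(P ^+ b) x y - pi 0 y| <=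
  expR (1 / 2 - gamma_ps pi P * b%:R / 4) / pi_star pi * pi 0 y.
Proof.
set s := sqrt_row pi; have s0 z : 0 < s 0 z by apply: sqrt_row_gt0.
have s2 z : s 0 z ^+ 2 = pi 0 z by apply: sqrt_row_sqr.
pose e : 'rV[R]_n := delta_mx 0 y; pose v := e - s 0 y *: s.
have ss : dot s s = 1 by apply: dot_sqrt_row.
have se : dot s e = s 0 y by apply: dot_delta.
have ee : dot e e = 1 by rewrite dot_delta mxE !eqxx.
have vs : dot v s = 0 by rewrite dotBl dotZl ss dotC se mulr1 subrr.
have vv : dot v v <= 1.
  rewrite dotBr dotZr vs mulr0 subr0 dotBl dotZl se ee gerBl -expr2 sqr_ge0 //.
set E := expR (1 / 2 - gamma_ps pi P * b%:R / 4).
have decay : dot (v *m (L ^+ b)^T) (v *m (L ^+ b)^T) <= E ^+ 2.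
  apply: (le_trans (symmetrize_pow_decay b vs)); apply: (@le_trans _ _ (expR (1 - gamma_ps pi P * b%:R / 2) * 1)).
    by rewrite ler_wpM2l ?expR_ge0.
  by rewrite mulr1 /E -expRM_natl ler_expR; lra.
have coord : (v *m (L ^+ b)^T) 0 x = s 0 x * ((P ^+ b) x y - pi 0 y) / s 0 y.
  have sL : s *m (L ^+ b)^T = s.
    by rewrite /L -symmetrizeX // sqrt_row_symmetrize_tr //; exact: preservesX.
  have sub (a c : 'rV[R]_n) : (a - c) 0 x = a 0 x - c 0 x by rewrite !mxE.
  have scl c (a : 'rV[R]_n) : (c *: a) 0 x = c * a 0 x by rewrite mxE.
  rewrite /v mulmxBl -scalemxAl sL -rowE sub -symmetrizeX // [row _ _ 0 x]mxE.
  rewrite [_^T y x]mxE [symmetrize _ _ x y]mxE scl -/s -s2.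
  by field; rewrite gt_eqF.
have bound : `|s 0 x * ((P ^+ b) x y - pi 0 y) / s 0 y| <= E.
  rewrite -coord -ler_sqr ?nnegrE ?expR_ge0 // real_normK ?num_real //.
  apply: le_trans decay; rewrite dotE (bigD1 x) //= -expr2 lerDl.
  by apply: sumr_ge0 => z _; rewrite -expr2 sqr_ge0.
rewrite !normrM normfV !(gtr0_norm (s0 _)) in bound.
have ps0 := pi_star_gt0.
have psxy : pi_star pi <= s 0 x * s 0 y.
  rewrite -ler_sqr ?nnegrE ?mulr_ge0 ?(ltW (s0 _)) ?(ltW ps0) //.
  by rewrite exprMn !s2 expr2 ler_pM ?(ltW ps0) ?pi_star_le.
rewrite ler_pdivrMr // in bound.
set D := `|_| in bound *.
rewrite mulrAC ler_pdivlMr //.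
apply: (@le_trans _ _ (D * (s 0 x * s 0 y))); first by rewrite ler_wpM2l // /D normr_ge0.
have : s 0 x * D * s 0 y <= E * s 0 y * s 0 y by rewrite ler_wpM2r // ltW.
by rewrite -s2; lra.
Qed.

End PseudoSpectralGap.

(** * Concentration of the empirical transition matrix *)

Section Samples.
Context {n : nat} (n_gt1 : (1 < n)%N).
Variables (P : 'M[R]_n) (pi : 'rV[R]_n).
Hypothesis statP : stationary P pi.
Hypothesis pi_gt0 : forall x, 0 < pi 0 x.
Variable Q : 'M[R]_n.
Hypothesis hQ : preserves pi Q.

Let s := sqrt_row pi.
Let ps := pi_star pi.
Let pi_sum : \sum_x pi 0 x = 1 := proj2 (proj1 statP).

(* The rank-one matrices [w^T w] average to the block matrix (1, L; L^T, 1) with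
   L = D^{1/2} Q D^{-1/2}, so that one concentration bound controls both the
   occupation counts and the transition counts. *)
Definition sample_row (x y : 'I_n) : 'rV[R]_(n + n) :=
  row_mx ((sqrt_row pi 0 x)^-1 *: delta_mx 0 x) ((sqrt_row pi 0 y)^-1 *: delta_mx 0 y).

Definition sample_mx x y : 'M[R]_(n + n) := (sample_row x y)^T *m sample_row x y.

Definition mean_mx : 'M[R]_(n + n) := \sum_x \sum_y (pi 0 x * Q x y) *: sample_mx x y.

Implicit Types v : 'rV[R]_(n + n).

Let s_gt0 x : 0 < s 0 x. Proof. exact: sqrt_row_gt0. Qed.
Let s_neq0 x : s 0 x != 0. Proof. by rewrite gt_eqF. Qed.
Let s_sqr x : s 0 x ^+ 2 = pi 0 x. Proof. exact: sqrt_row_sqr. Qed.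
Let ps_gt0 : 0 < ps. Proof. exact: pi_star_gt0. Qed.
Let ps_half : ps <= 1 / 2. Proof. exact: (pi_star_le_half n_gt1 statP pi_gt0). Qed.
Let Q_ge0 x y : 0 <= Q x y. Proof. exact: (proj1 (proj1 hQ)). Qed.
Let piQ y : \sum_x pi 0 x * Q x y = pi 0 y.
Proof. by have := proj2 hQ => /rowP/(_ y); rewrite mxE. Qed.

Lemma dot_row_mx p q (a c : 'rV[R]_p) (b d : 'rV[R]_q) :
  dot (row_mx a b) (row_mx c d) = dot a c + dot b d.
Proof. by rewrite /dot tr_row_mx mul_row_col mxE. Qed.

Lemma sample_mx_mul v x y : v *m sample_mx x y = dot v (sample_row x y) *: sample_row x y.
Proof. by rewrite /sample_mx mulmxA [v *m _]mx11_scalar mul_scalar_mx. Qed.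

Lemma sample_form v x y : dot (v *m sample_mx x y) v = dot v (sample_row x y) ^+ 2.
Proof. by rewrite sample_mx_mul dotZl dotC expr2. Qed.

Lemma sample_mx_sym x y : (sample_mx x y)^T = sample_mx x y.
Proof. by rewrite trmx_mul trmxK. Qed.

Lemma mean_mx_sym : mean_mx^T = mean_mx.
Proof.
rewrite /mean_mx linear_sum; apply: eq_bigr => x _ /=; rewrite linear_sum.
by apply: eq_bigr => y _ /=; rewrite linearZ /= sample_mx_sym.
Qed.

Lemma mean_form v : dot (v *m mean_mx) v =
  \sum_x \sum_y pi 0 x * Q x y * dot v (sample_row x y) ^+ 2.
Proof.
rewrite mulmx_sumr dot_suml; apply: eq_bigr => x _; rewrite mulmx_sumr dot_suml.
by apply: eq_bigr => y _; rewrite -scalemxAr dotZl sample_form.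
Qed.

Lemma dot_sample_row a b x y :
  dot (row_mx a b) (sample_row x y) = a 0 x / s 0 x + b 0 y / s 0 y.
Proof. by rewrite dot_row_mx !dotZr !dot_delta ![_^-1 * _]mulrC. Qed.

Lemma sample_row_norm x y : dot (sample_row x y) (sample_row x y) <= 2 / ps.
Proof.
rewrite dot_row_mx !dotZl !dotZr !dot_delta !mxE !eqxx !mulr1 -!expr2 !exprVn.
have h z : (Num.sqrt (pi 0 z) ^+ 2)^-1 <= ps^-1.
  rewrite sqr_sqrtr; last exact: ltW.
  by rewrite lef_pV2 ?posrE //; exact: pi_star_le.
by have := lerD (h x) (h y); rewrite [2 / _]mulrC mulr_natr mulr2n.
Qed.

Lemma sample_form_le v x y : dot v (sample_row x y) ^+ 2 <= 2 / ps * dot v v.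
Proof.
apply: (le_trans (cauchy_schwarz _ _)); rewrite mulrC.
by apply: ler_wpM2r (sample_row_norm _ _); exact: dotvv_ge0.
Qed.

Lemma mean_form_ge0 v : 0 <= dot (v *m mean_mx) v.
Proof.
rewrite mean_form sumr_ge0 // => x _; rewrite sumr_ge0 // => y _.
apply: mulr_ge0 (sqr_ge0 _); apply: mulr_ge0 (Q_ge0 _ _); exact: ltW.
Qed.

Lemma mean_form_row_mx a b : dot (row_mx a b *m mean_mx) (row_mx a b) =
  dot a a + dot b b + 2 * dot (a *m symmetrize pi Q) b.
Proof.
rewrite mean_form.
transitivity (\sum_x \sum_y (a 0 x ^+ 2 * Q x y + pi 0 x * Q x y * (b 0 y / s 0 y) ^+ 2
    + 2 * (a 0 x * symmetrize pi Q x y * b 0 y))).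
  apply: eq_bigr => x _; apply: eq_bigr => y _; rewrite dot_sample_row.
  rewrite [symmetrize pi Q x y]mxE -/s -s_sqr; field; by rewrite !s_neq0.
under eq_bigr do rewrite !big_split /= -mulr_sumr (proj2 (proj1 hQ)) mulr1.
rewrite !big_split /=; congr (_ + _ + _).
- by rewrite dotE; apply: eq_bigr => x _; rewrite expr2.
- rewrite exchange_big dotE; apply: eq_bigr => y _ /=.
  by rewrite -mulr_suml piQ -s_sqr; field; rewrite s_neq0.
- rewrite exchange_big dotE mulr_sumr; apply: eq_bigr => y _ /=.
  by rewrite -mulr_sumr mxE mulr_suml.
Qed.

(** Nonnegativity of the form at [(a, -b)] bounds the cross term by [|a|^2 + |b|^2]. *)
Lemma mean_form_le v : dot (v *m mean_mx) v <= 2 * dot v v.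
Proof.
rewrite -[v]hsubmxK; set a := lsubmx v; set b := rsubmx v.
have h := mean_form_row_mx a b; have h' := mean_form_ge0 (row_mx a (- b)).
rewrite mean_form_row_mx !(dotNl, dotNr) opprK in h'.
by rewrite h dot_row_mx; lra.
Qed.

(** Cauchy-Schwarz for the mean form, applied to [v] and [u = v *m mean_mx], gives
    [|u|^4 <= (2 |v|^2) (2 |u|^2)]. *)
Lemma mean_mx_norm v : dot (v *m mean_mx) (v *m mean_mx) <= 4 * dot v v.
Proof.
set u := v *m mean_mx.
have := psd_cauchy_schwarz v u mean_mx_sym mean_form_ge0; rewrite -/u => h.
have u0 := dotvv_ge0 u; have hv := mean_form_le v; have hu := mean_form_le u.
have v0 := mean_form_ge0 v.
have [->|u1] := eqVneq (dot u u) 0; first by have := dotvv_ge0 v; lra.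
have up : 0 < dot u u by rewrite lt_neqAle eq_sym u1.
rewrite -(ler_pM2r up) -expr2; apply: (le_trans h).
apply: (le_trans (ler_pM v0 (mean_form_ge0 u) hv hu)).
by rewrite le_eqVlt; apply/orP; left; apply/eqP; ring.
Qed.

Variables (A : 'I_n -> 'I_n -> R) (beta theta : R) (sg : bool).
Hypothesis A_near : forall x y, `|A x y - pi 0 y| <= beta * pi 0 y.
Hypothesis A_ge0 : forall x y, 0 <= A x y.
Hypothesis A_sum : forall x, \sum_y A x y = 1.
Hypothesis beta_small : 0 <= beta <= 1 / 2.
Hypothesis theta_small : 0 <= theta <= ps / 4.

Let sgn_theta : `|(-1) ^+ sg * theta| = theta.
Proof.
have /andP[t0 _] := theta_small.
by rewrite normrM normrX normrN1 expr1n mul1r ger0_norm.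
Qed.

Definition centred_sample x y : 'M[R]_(n + n) :=
  ((-1) ^+ sg * theta) *: (sample_mx x y - mean_mx).

Lemma centred_sample_sym x y : (centred_sample x y)^T = centred_sample x y.
Proof. by rewrite /centred_sample linearZ /= linearB /= sample_mx_sym mean_mx_sym. Qed.

Lemma centred_form v x y : dot (v *m centred_sample x y) v =
  (-1) ^+ sg * theta * (dot v (sample_row x y) ^+ 2 - dot (v *m mean_mx) v).
Proof. by rewrite -scalemxAr dotZl mulmxBr dotBl sample_form. Qed.

Lemma deviation_le v x y :
  `|dot v (sample_row x y) ^+ 2 - dot (v *m mean_mx) v| <= 2 / ps * dot v v.
Proof.
have h1 := sample_form_le v x y; have h2 := mean_form_le v; have h3 := mean_form_ge0 v.
have h4 := sqr_ge0 (dot v (sample_row x y)); have v0 := dotvv_ge0 v.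
have h5 : 2 * dot v v <= 2 / ps * dot v v.
  by apply: ler_wpM2r => //; rewrite ler_pdivlMr //; have := ps_half; lra.
by rewrite ler_norml; apply/andP; split; lra.
Qed.

Lemma centred_form_half x y v : `|dot (v *m centred_sample x y) v| <= 1 / 2 * dot v v.
Proof.
have /andP[t0 t1] := theta_small.
rewrite centred_form normrM sgn_theta.
apply: (le_trans (ler_wpM2l t0 (deviation_le v x y))); rewrite mulrA.
apply: ler_wpM2r; first exact: dotvv_ge0.
by rewrite mulrA ler_pdivrMr //; lra.
Qed.

Let q x (p : 'I_n * 'I_n) := A x p.1 * Q p.1 p.2.

Let sum_q x v : \sum_p q x p * dot v (sample_row p.1 p.2) ^+ 2 =
  \sum_y \sum_z A x y * Q y z * dot v (sample_row y z) ^+ 2.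
Proof. by rewrite (pair_bigA _ (fun y z => A x y * Q y z * dot v (sample_row y z) ^+ 2)). Qed.

Let q_sum x : \sum_p q x p = 1.
Proof. exact: (skel_weight_sum A_sum (proj2 (proj1 hQ))). Qed.

Lemma sample_mean_near x v :
  `|\sum_p q x p * dot v (sample_row p.1 p.2) ^+ 2 - dot (v *m mean_mx) v| <=
  beta * dot (v *m mean_mx) v.
Proof.
rewrite sum_q mean_form -sumrB; apply: (le_trans (ler_norm_sum _ _ _)).
rewrite mulr_sumr; apply: ler_sum => y _; rewrite -sumrB.
apply: (le_trans (ler_norm_sum _ _ _)); rewrite mulr_sumr; apply: ler_sum => z _.
rewrite -mulrBl -mulrBl normrM (ger0_norm (sqr_ge0 _)) normrM (ger0_norm (Q_ge0 _ _)).
rewrite [leRHS]mulrA [X in _ <= X * _]mulrA.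
apply: ler_wpM2r; first exact: sqr_ge0.
by apply: ler_wpM2r; [exact: Q_ge0|exact: A_near].
Qed.

(** The sample part is bounded by its own quadratic form times [1 / ps], not by its worst value. On
    averaging, the form is of order 1, so only one factor [1 / ps] remains in the variance. *)
Lemma centred_norm_le v x y :
  dot (v *m centred_sample x y) (v *m centred_sample x y) <=
  theta ^+ 2 * (4 / ps * dot v (sample_row x y) ^+ 2 + 8 * dot v v).
Proof.
rewrite -scalemxAr dotZl dotZr mulrA.
rewrite [X in X * _](_ : _ = theta ^+ 2); last by case: (sg); rewrite /=; ring.
apply: ler_wpM2l; first exact: sqr_ge0.
rewrite mulmxBr; set a := v *m sample_mx x y; set b := v *m mean_mx.
have hab : dot (a - b) (a - b) <= 2 * dot a a + 2 * dot b b.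
  by have := dotvv_ge0 (a + b); rewrite !(dotDl, dotDr, dotNl, dotNr) (dotC b a); lra.
apply: (le_trans hab); have hb : dot b b <= 4 * dot v v := mean_mx_norm v.
have ha : dot a a <= 2 / ps * dot v (sample_row x y) ^+ 2.
  rewrite /a sample_mx_mul dotZl dotZr mulrA -expr2 mulrC.
  by apply: ler_wpM2r (sample_row_norm x y); exact: sqr_ge0.
by lra.
Qed.

(** [2 theta beta] is the bias left by imperfect mixing, as the mean form is at most 2. In the
    variance term [32 = 2 * (4 * 3 + 4)]: the averaged sample form is at most 3, and
    [8 <= 4 / ps]. *)
Lemma centred_mgf x v : \sum_p A x p.1 * Q p.1 p.2 *
    (dot (v *m centred_sample p.1 p.2) v +
     2 * dot (v *m centred_sample p.1 p.2) (v *m centred_sample p.1 p.2)) <=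
  (1 + 2 * theta * beta + 32 * theta ^+ 2 / ps - 1) * dot v v.
Proof.
have /andP[t0 t1] := theta_small; have /andP[b0 b1] := beta_small.
set Q0 := dot (v *m mean_mx) v; have Q0_le : Q0 <= 2 * dot v v := mean_form_le v.
have Q0_ge0 : 0 <= Q0 := mean_form_ge0 v.
have near := sample_mean_near x v; set Q1 := \sum_p _ in near.
have v0 := dotvv_ge0 v; have q0 p : 0 <= q x p by apply: mulr_ge0.
apply: (@le_trans _ _ (\sum_p q x p * ((-1) ^+ sg * theta * (dot v (sample_row p.1 p.2) ^+ 2 - Q0) +
    2 * (theta ^+ 2 * (4 / ps * dot v (sample_row p.1 p.2) ^+ 2 + 8 * dot v v))))).
  apply: ler_sum => p _; apply: ler_wpM2l; first exact: q0.
  by rewrite centred_form lerD2l; apply: ler_wpM2l (centred_norm_le _ _ _).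
rewrite [leLHS](_ : _ = (-1) ^+ sg * theta * (Q1 - Q0) +
    2 * (theta ^+ 2 * (4 / ps * Q1 + 8 * dot v v))); last first.
  have e (c e : R) : \sum_p q x p * (c * dot v (sample_row p.1 p.2) ^+ 2 + e) = c * Q1 + e.
    under eq_bigr do rewrite mulrDr mulrCA.
    by rewrite big_split /= -mulr_sumr -mulr_suml q_sum mul1r.
  rewrite (eq_bigr (fun p => q x p * (((-1) ^+ sg * theta + 8 * theta ^+ 2 / ps) *
     dot v (sample_row p.1 p.2) ^+ 2 + (16 * theta ^+ 2 * dot v v - (-1) ^+ sg * theta * Q0)))).
    by rewrite e; ring.
  by move=> p _; congr (_ * _); ring.
have h1 : (-1) ^+ sg * theta * (Q1 - Q0) <= theta * (beta * (2 * dot v v)).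
  apply: (le_trans (ler_norm _)).
  rewrite normrM sgn_theta; apply: ler_wpM2l => //.
  by apply: (le_trans near); apply: ler_wpM2l.
have hQ1 : Q1 <= 3 * dot v v.
  have : Q1 - Q0 <= 1 / 2 * Q0.
    by apply: (le_trans (ler_norm _)); apply: (le_trans near); apply: ler_wpM2r.
  lra.
have h2 : theta ^+ 2 * (4 / ps * Q1 + 8 * dot v v) <= theta ^+ 2 * (16 / ps * dot v v).
  apply: ler_wpM2l; first exact: sqr_ge0.
  have a1 : 4 / ps * Q1 <= 4 / ps * (3 * dot v v) by apply: ler_wpM2l => //; rewrite divr_ge0 // ltW.
  have a2 : 8 * dot v v <= 4 / ps * dot v v.
    by by apply: ler_wpM2r => //; rewrite ler_pdivlMr //; have := ps_half; lra.
  by lra.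
by apply: (le_trans (lerD h1 (ler_wpM2l _ h2))) => //; lra.
Qed.

End Samples.

(** * Tail bound along one residue class *)

Section Concentration.
Context {n : nat} (n_gt1 : (1 < n)%N).
Variables (P : 'M[R]_n) (pi mu : 'rV[R]_n).
Hypothesis sP : row_stochastic P.
Hypothesis statP : stationary P pi.
Hypothesis pi_gt0 : forall x, 0 < pi 0 x.
Hypothesis mu_dist : is_distribution mu.

Definition deviation k (x0 : 'I_n) (p : seq 'I_n) (v : 'rV[R]_(n + n)) t : R :=
  dot v (sample_row pi (nth x0 p t) (nth x0 p (t + k))) ^+ 2 -
  dot (v *m mean_mx pi (P ^+ k)) v.

(** The largest eigenvalue of the signed sum of [sample_mx - mean_mx] at the [J] positions reaches
    [J a1]; the two values of [sg] give the two tails. *)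
Definition large_deviation k x0 a1 (sg : bool) J (pos : nat -> nat) (p : seq 'I_n) : Prop :=
  exists2 v, v != 0 &
    J%:R * a1 * dot v v <= (-1) ^+ sg * \sum_(j < J) deviation k x0 p v (pos j).

Variables (k g a J m : nat) (x0 : 'I_n) (a1 : R) (sg : bool).
Hypothesis a1_bound : 0 < a1 <= 1.
Hypothesis mix : forall x y, `|(P ^+ g) x y - pi 0 y| <= a1 / 16 * pi 0 y.
Hypothesis fits : (a + J * (g + k) <= m)%N.

Let ps := pi_star pi.
(** With [beta = a1 / 16] the exponent per sample is [32 theta^2 / ps - 3 theta a1 / 8]; this
    near-optimal [theta] makes it exactly [- a1^2 ps / 1024]. *)
Let theta := a1 * ps / 256.
Let X := centred_sample pi (P ^+ k) theta sg.
Let ps_gt0 : 0 < ps. Proof. exact: pi_star_gt0. Qed.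
Let ps_half : ps <= 1 / 2. Proof. exact: (pi_star_le_half n_gt1 statP pi_gt0). Qed.
Let theta_gt0 : 0 < theta.
Proof. by have /andP[h _] := a1_bound; have := mulr_gt0 h ps_gt0; rewrite /theta; lra. Qed.
Let hQ : preserves pi (P ^+ k) := preservesX k (conj sP (proj2 statP)).

Let skip_sum_form v p : dot (v *m skip_sum X x0 g k J p) v =
  theta * ((-1) ^+ sg * \sum_(j < J) deviation k x0 p v (g + j * (g + k))).
Proof.
rewrite mulmx_sumr dot_suml !mulr_sumr; apply: eq_bigr => j _.
by rewrite centred_form /deviation; ring.
Qed.

Let event_eq p : large_deviation k x0 a1 sg J (fun j => a + g + j * (g + k))%N p <->
  top_form_ge (theta * (J%:R * a1)) (0 + skip_sum X x0 g k J (drop a p)).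
Proof.
have e v : dot (v *m skip_sum X x0 g k J (drop a p)) v =
    theta * ((-1) ^+ sg * \sum_(j < J) deviation k x0 p v (a + g + j * (g + k))).
  rewrite skip_sum_form; congr (_ * (_ * _)); apply: eq_bigr => j _.
  by rewrite /deviation !nth_drop !addnA.
have key v : (theta * (J%:R * a1) * dot v v <= dot (v *m skip_sum X x0 g k J (drop a p)) v) =
    (J%:R * a1 * dot v v <=
     (-1) ^+ sg * \sum_(j < J) deviation k x0 p v (a + g + j * (g + k))).
  by rewrite e -[leLHS]mulrA ler_pM2l.
by rewrite add0r; split=> -[v v0 h]; exists v; rewrite // ?key // -key.
Qed.

(** The bound from [skel_tail] is uniform in the state at time [a], so it survives averaging over
    the unknown law of that state. The factor [2 n] is the dimension of the block matrices. *)
Lemma deviation_tail :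
  prob mu P (fun w : cpath n m.+1 =>
    `[< large_deviation k x0 a1 sg J (fun j => a + g + j * (g + k))%N (codom w) >]) <=
  2 * n%:R * expR (- (J%:R * a1 ^+ 2 * ps / 1024)).
Proof.
have /andP[a10 a11] := a1_bound.
pose phi (S : 'M[R]_(n + n)) : R := `[< top_form_ge (theta * (J%:R * a1)) S >]%:R.
pose F p := phi (0 + skip_sum X x0 g k J p).
have [mu0 mu1] := mu_dist.
rewrite (prob_traj P mu m (fun p => `[< large_deviation k x0 a1 sg J (fun j => a + g + j * (g + k))%N p >])).
set bd := 2 * _ * _.
have key x : traj P (m - a) x F <= bd.
  rewrite /F (traj_skel sP); last by lia.
  have sg_ := row_stochasticX sP g; have sk_ := row_stochasticX sP k.
  have beta_small : 0 <= a1 / 16 <= 1 / 2 by apply/andP; split; lra.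
  have theta_small : 0 <= theta <= ps / 4.
    apply/andP; split; first exact: ltW.
    have h : a1 * ps <= ps by rewrite ger_pMl.
    by have := ps_gt0; rewrite /theta; lra.
  have rho0 : 0 <= 1 + 2 * theta * (a1 / 16) + 32 * theta ^+ 2 / ps.
    have h1 := divr_ge0 (sqr_ge0 theta) (ltW ps_gt0).
    by have h2 := mulr_gt0 theta_gt0 a10; lra.
  apply: (le_trans (skel_tail (proj1 sg_) (proj1 sk_) (proj2 sg_) (proj2 sk_)
    (centred_sample_sym pi (P ^+ k) theta sg) rho0
    (centred_form_half n_gt1 statP pi_gt0 hQ sg theta_small)
    (centred_mgf n_gt1 statP pi_gt0 hQ sg mix (proj1 sg_) (proj2 sg_) beta_small theta_small)
    J x _)).
    exact: (mulr_ge0 (ltW theta_gt0) (mulr_ge0 (ler0n _ _) (ltW a10))).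
  rewrite [X in X * _ * _](_ : _ = 2 * n%:R); last by rewrite natrD; ring.
  rewrite -mulrA /bd; apply: ler_wpM2l; first by rewrite mulr_ge0.
  apply: (@le_trans _ _ (expR (J%:R * (2 * theta * (a1 / 16) + 32 * theta ^+ 2 / ps)) *
      expR (- (theta * (J%:R * a1) / 2)))).
    apply: ler_wpM2r; first exact: expR_ge0.
    by rewrite expRM_natl; apply: lerXn2r; rewrite ?nnegrE ?expR_ge0 // -addrA expR_ge1Dx.
  rewrite -exp.expRD ler_expR le_eqVlt; apply/orP; left; apply/eqP.
  by rewrite /theta; field; rewrite gt_eqF.
rewrite -[leRHS]mul1r -[X in _ <= X * _]mu1 mulr_suml; apply: ler_sum => x _; apply: ler_wpM2l => //.
rewrite (_ : traj _ _ _ _ = traj P (a + (m - a)) x (fun p => F (drop a p))); last first.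
  rewrite subnKC; last by lia.
  by apply: eq_traj => p _; rewrite /F /phi (asbool_equiv_eq (event_eq _)).
rewrite traj_drop -[leRHS]mul1r -[X in _ <= X * _](proj2 (row_stochasticX sP a) x) mulr_suml.
apply: ler_sum => y _; apply: ler_wpM2l; first exact: (proj1 (row_stochasticX sP a)).
exact: key.
Qed.

End Concentration.

(** Classes are sampled from [j + 1] on, so that a full gap precedes every sample. The first [s]
    terms and the at most [s] terms from [s * J.+1] on are bounded by [C] each. *)
Lemma sum_residues (D : nat -> R) s J T B C : (0 < s)%N ->
  (s * J.+1 <= T)%N -> (T <= s * J.+2)%N ->
  (forall r, (r < s)%N -> `|\sum_(j < J) D (r + s * j.+1)%N| <= B) ->
  (forall t, `|D t| <= C) ->
  `|\sum_(t < T) D t| <= s%:R * B + 2 * s%:R * C.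
Proof.
move=> s0 lT Tu hB hC.
have C0 : 0 <= C by apply: le_trans (hC 0%N).
have hsum a b : (a <= b)%N -> (b <= a + s)%N -> `|\sum_(a <= t < b) D t| <= s%:R * C.
  move=> ab bs; apply: (le_trans (ler_norm_sum _ _ _)).
  apply: (@le_trans _ _ (\sum_(a <= t < b) C)); first by apply: ler_sum => t _.
  rewrite sumr_const_nat -[leLHS]mulr_natl ler_wpM2r // ler_nat; lia.
rewrite -(big_mkord xpredT) (big_cat_nat (n := s)) //=; last by lia.
rewrite (big_cat_nat (n := (s * J.+1)%N) (m := s)) //=; last by lia.
have -> : \sum_(s <= t < s * J.+1) D t = \sum_(r < s) \sum_(j < J) D (r + s * j.+1)%N.
  rewrite exchange_big /=; elim: J {lT Tu hB} => [|J IH]; first by rewrite muln1 big_geq ?big_ord0.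
  rewrite (big_cat_nat (n := (s * J.+1)%N)) /=; [|by lia|by lia].
  rewrite IH big_ord_recr /=; congr (_ + _).
  rewrite -{1}[(s * J.+1)%N]add0n big_addn (_ : (s * J.+2 - s * J.+1 = s)%N); last by lia.
  by rewrite big_mkord.
apply: (le_trans (ler_normD _ _)).
have h1 := hsum 0%N s (leq0n _) (leqnn _).
have h3 : `|\sum_(s * J.+1 <= t < T) D t| <= s%:R * C by apply: hsum => //; lia.
have h2 : `|\sum_(r < s) \sum_(j < J) D (r + s * j.+1)%N| <= s%:R * B.
  apply: (le_trans (ler_norm_sum _ _ _)).
  apply: (@le_trans _ _ (\sum_(r < s) B)); first by apply: ler_sum => r _; apply: hB.
  by rewrite sumr_const card_ord mulr_natl.
have := ler_normD (\sum_(r < s) \sum_(j < J) D (r + s * j.+1)%N) (\sum_(s * J.+1 <= t < T) D t).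
by lra.
Qed.

(** * From the empirical matrix to the estimator *)

Definition norm2 {n} (v : 'rV[R]_n) : R := Num.sqrt (dot v v).

Section Norm2.
Context {n : nat}.
Implicit Types u v : 'rV[R]_n.

Lemma norm2_ge0 v : 0 <= norm2 v. Proof. exact: sqrtr_ge0. Qed.

Lemma norm2_sqr v : norm2 v ^+ 2 = dot v v.
Proof. by rewrite sqr_sqrtr ?dotvv_ge0. Qed.

Lemma norm2_le v c : 0 <= c -> dot v v <= c ^+ 2 -> norm2 v <= c.
Proof. by move=> c0 h; rewrite -ler_sqr ?nnegrE ?norm2_ge0 // norm2_sqr. Qed.

Lemma norm2D u v : norm2 (u + v) <= norm2 u + norm2 v.
Proof.
apply: norm2_le; first by rewrite addr_ge0 ?norm2_ge0.
have h : dot u v <= norm2 u * norm2 v.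
  apply: (le_trans (ler_norm _)).
  rewrite -ler_sqr ?nnegrE ?mulr_ge0 ?norm2_ge0 // real_normK ?num_real //.
  by rewrite exprMn !norm2_sqr cauchy_schwarz.
by rewrite !(dotDl, dotDr) (dotC v u) sqrrD !norm2_sqr; lra.
Qed.

Lemma norm2_diag (d : 'rV[R]_n) c v : 0 <= c -> (forall i, `|d 0 i| <= c) ->
  norm2 (v *m diag_mx d) <= c * norm2 v.
Proof.
move=> c0 hd; apply: norm2_le; first by rewrite mulr_ge0 ?norm2_ge0.
rewrite exprMn norm2_sqr !dotE mulr_sumr; apply: ler_sum => i _.
rewrite mul_mx_diag !mxE -!expr2 exprMn mulrC; apply: ler_wpM2r; first exact: sqr_ge0.
by rewrite -real_normK ?num_real // ler_sqr ?nnegrE.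
Qed.

End Norm2.

(** * Effect of random normalization and of empirical noise on the Gram form *)

Section Perturbation.
Context {n : nat}.
Variables (L M : 'M[R]_n) (G : 'I_n -> R) (alpha : R).
Hypothesis alpha_bound : 0 < alpha <= 1 / 4.
Hypothesis L_contr : forall v, dot (v *m L^T) (v *m L^T) <= dot v v.
Hypothesis G_near : forall x, `|G x - 1| <= alpha.
Hypothesis M_near : forall a b,
  `|dot (a *m M) b - dot (a *m L) b| <= alpha * (dot a a + dot b b) / 2.

Let d : 'rV[R]_n := \row_x (Num.sqrt (G x))^-1.

(** For [alpha <= 1 / 4] one has [(1 - alpha)^2 (1 + alpha) < 1 < (1 + alpha)^2 (1 - alpha)], which
    excludes any other position of [1 / sqrt G]. *)
Let d_near x : `|d 0 x - 1| <= alpha.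
Proof.
have /andP[a0 a1] := alpha_bound; have := G_near x; rewrite ler_norml => /andP[g0 g1].
have Gp : 0 < G x by lra.
rewrite mxE; set e := _^-1; have e0 : 0 < e by rewrite invr_gt0 sqrtr_gt0.
have e2 : e ^+ 2 * G x = 1 by rewrite exprVn sqr_sqrtr ?ltW // mulVf ?gt_eqF.
rewrite ler_norml; apply/andP; split.
- rewrite leNgt; apply/negP => h; have h1 : e ^+ 2 <= (1 - alpha) ^+ 2.
    by rewrite ler_sqr ?nnegrE; lra.
  have h2 : e ^+ 2 * G x <= (1 - alpha) ^+ 2 * (1 + alpha).
    by apply: ler_pM; rewrite ?sqr_ge0 //; lra.
  by have := mulr_gt0 a0 a0; nra.
- rewrite leNgt; apply/negP => h; have h1 : (1 + alpha) ^+ 2 <= e ^+ 2.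
    by rewrite ler_sqr ?nnegrE; lra.
  have h2 : (1 + alpha) ^+ 2 * (1 - alpha) <= e ^+ 2 * G x.
    by apply: ler_pM; rewrite ?sqr_ge0 //; lra.
  by have := mulr_gt0 a0 a0; nra.
Qed.

Let norm2_L v : norm2 (v *m L^T) <= norm2 v.
Proof. by apply: norm2_le; rewrite ?norm2_ge0 // norm2_sqr. Qed.

Let norm2_ML v : norm2 (v *m M^T - v *m L^T) <= alpha * norm2 v.
Proof.
have /andP[a0 _] := alpha_bound.
apply: norm2_le; first by rewrite mulr_ge0 ?norm2_ge0 // ltW.
(* [M_near] is not homogeneous in each argument; scaling [u] by [alpha^-1] balances its two terms
   and turns it into an operator-norm bound. *)
set u := _ - _; have h := M_near (alpha^-1 *: u) v.
have e : dot ((alpha^-1 *: u) *m M) v - dot ((alpha^-1 *: u) *m L) v = alpha^-1 * dot u u.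
  rewrite !dot_mulmxl -dotBr -/u dotZl //.
rewrite e dotZl dotZr in h.
have h' := le_trans (ler_norm _) h; rewrite exprMn norm2_sqr.
have : alpha * (alpha^-1 * dot u u) <= alpha * (alpha * (alpha^-1 * (alpha^-1 * dot u u) + dot v v) / 2).
  by rewrite ler_wpM2l // ltW.
rewrite mulVKf ?gt_eqF // => h2.
have e2 : alpha * (alpha * (alpha^-1 * (alpha^-1 * dot u u) + dot v v) / 2) =
   (dot u u + alpha ^+ 2 * dot v v) / 2 by field; rewrite gt_eqF.
by rewrite e2 in h2; lra.
Qed.

Let norm2_d1 v : norm2 (v *m diag_mx d - v) <= alpha * norm2 v.
Proof.
have /andP[a0 _] := alpha_bound.
have -> : v *m diag_mx d - v = v *m diag_mx (\row_x (d 0 x - 1)).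
  by apply/rowP => x; rewrite !mul_mx_diag !mxE; ring.
apply: norm2_diag => [|i]; first exact: ltW.
by rewrite [X in `|X|]mxE d_near.
Qed.

Let norm2_d v : norm2 (v *m diag_mx d) <= (1 + alpha) * norm2 v.
Proof.
by have := norm2D (v *m diag_mx d - v) v; rewrite subrK; have := norm2_d1 v; lra.
Qed.

(** [12 = 4 * 3]: the three successive errors add up to [|p - q| <= (25/16 + 5/4 + 1) alpha |v| <= 4
    alpha |v|], while [|p| + |q| <= 3 |v|]. *)
Lemma gram_perturb (Lh : 'M[R]_n) v :
  (forall x y, Lh x y = M x y / (Num.sqrt (G x) * Num.sqrt (G y))) ->
  `|dot (v *m Lh^T) (v *m Lh^T) - dot (v *m L^T) (v *m L^T)| <= 12 * alpha * dot v v.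
Proof.
move=> hLh; have /andP[a0 a1] := alpha_bound.
have -> : Lh = diag_mx d *m M *m diag_mx d.
  apply/matrixP => x y; rewrite mul_mx_diag mxE mul_diag_mx mxE hLh !mxE invfM.
  by rewrite mulrCA !mulrA.
rewrite !trmx_mul !tr_diag_mx !mulmxA; set u := v *m diag_mx d.
set p := u *m M^T *m diag_mx d; set q := v *m L^T.
have N0 := norm2_ge0 v; set N := norm2 v in N0 *.
have uN : norm2 u <= (1 + alpha) * N := norm2_d v.
have uM : norm2 (u *m M^T) <= (1 + alpha) * ((1 + alpha) * N).
  rewrite -[X in norm2 X](subrK (u *m L^T)); apply: (le_trans (norm2D _ _)).
  have := norm2_ML u; have := norm2_L u.
  have := ler_wpM2l (ltW a0) uN; lra.
have pq : norm2 (p - q) <= 4 * alpha * N.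
  have -> : p - q = (p - u *m M^T) + ((u *m M^T - u *m L^T) + (u - v) *m L^T).
    by rewrite mulmxBl -/q !addrA !subrK.
  apply: (le_trans (norm2D _ _)); have h1 := norm2_d1 (u *m M^T); rewrite -/p in h1.
  have h2 := norm2D (u *m M^T - u *m L^T) ((u - v) *m L^T).
  have h3 := norm2_ML u; have h4 := le_trans (norm2_L (u - v)) (norm2_d1 v).
  rewrite -/N in h4.
  have h5 := ler_wpM2l (ltW a0) uM; have h6 := ler_wpM2l (ltW a0) uN.
  have aN : 0 <= alpha * N by rewrite mulr_ge0 // ltW.
  have h7 : alpha * ((1 + alpha) * ((1 + alpha) * N)) <= alpha * N * (25 / 16).
    rewrite [leLHS](_ : _ = alpha * N * (1 + alpha) ^+ 2); last by ring.
    by apply: ler_wpM2l => //; nra.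
  have h8 : alpha * ((1 + alpha) * N) <= alpha * N * (5 / 4).
    rewrite [leLHS](_ : _ = alpha * N * (1 + alpha)); last by ring.
    by apply: ler_wpM2l => //; lra.
  lra.
have qN : norm2 q <= N := norm2_L v.
have h1 : norm2 p <= norm2 q + 4 * alpha * N.
  have := norm2D (p - q) q; rewrite subrK; lra.
have h2 : norm2 q <= norm2 p + 4 * alpha * N.
  have := norm2D (q - p) p; rewrite subrK.
  have -> : norm2 (q - p) = norm2 (p - q) by rewrite -opprB /norm2 dotNl dotNr opprK.
  lra.
rewrite -(norm2_sqr v) -/N -(norm2_sqr p) -(norm2_sqr q).
have p0 := norm2_ge0 p; have q0 := norm2_ge0 q.
set P := norm2 p in h1 h2 p0 *; set Q := norm2 q in h1 h2 q0 qN *.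
have e0 : 0 <= 4 * alpha * N by rewrite !mulr_ge0 // ltW.
have eN : 4 * alpha * N <= N by rewrite -[leRHS]mul1r ler_wpM2r //; lra.
have key : `|P ^+ 2 - Q ^+ 2| <= 4 * alpha * N * (3 * N).
  rewrite subr_sqr normrM; apply: ler_pM => //.
    by rewrite ler_norml; apply/andP; split; lra.
  by rewrite ger0_norm; lra.
apply: (le_trans key); rewrite le_eqVlt; apply/orP; left; apply/eqP; ring.
Qed.

End Perturbation.

Section Counts.
Context {n m : nat} (n_gt1 : (1 < n)%N).
Variables (P : 'M[R]_n) (pi : 'rV[R]_n).
Hypothesis sP : row_stochastic P.
Hypothesis statP : stationary P pi.
Hypothesis pi_gt0 : forall x, 0 < pi 0 x.
Variables (w : cpath n m.+1) (k : nat) (x0 : 'I_n).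
Hypothesis k_gt0 : (0 < k)%N.

Let T := nsteps m.+1 k.
Let N2 x y : R := (Ncount2 k w x y)%:R.
Let N x : R := (Ncount k w x)%:R.
Let s := sqrt_row pi.
Let pi_sum : \sum_x pi 0 x = 1 := proj2 (proj1 statP).
Let hQ : preserves pi (P ^+ k) := preservesX k (conj sP (proj2 statP)).
Let L := symmetrize pi (P ^+ k).

Lemma sum_transitions (phi : 'I_n -> 'I_n -> R) :
  \sum_(t < T) phi (nth x0 (codom w) (k * t)%N) (nth x0 (codom w) (k * t + k)%N) =
  \sum_x \sum_y N2 x y * phi x y.
Proof.
transitivity (\sum_x \sum_y \sum_(t < T)
    ((Xopt w (k * t) == Some x) && (Xopt w (k * t + k) == Some y))%:R * phi x y).
  under [RHS]eq_bigr do rewrite exchange_big /=.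
  rewrite [RHS]exchange_big /=; apply: eq_bigr => t _.
  have tT : (k * t.+1 <= m)%N.
    by have := ltn_ord t; rewrite /T /nsteps /= leq_divRL // mulnC.
  rewrite !(Xopt_codom w x0); [|lia|lia].
  set a := nth _ _ _; set b := nth _ _ _.
  rewrite (bigD1 a) //= (bigD1 b) //= !eqxx mul1r big1 => [|y yb]; last first.
    by rewrite (inj_eq Some_inj) [b == y]eq_sym (negbTE yb) andbF mul0r.
  rewrite addr0 big1 ?addr0 // => x xa; rewrite big1 // => y _.
  by rewrite (inj_eq Some_inj) [a == x]eq_sym (negbTE xa) mul0r.
apply: eq_bigr => x _; apply: eq_bigr => y _.
by rewrite -mulr_suml /N2 /Ncount2 natr_sum.
Qed.

(** Both counts run over the same times, so every counted visit has its counted transition. *)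
Lemma Ncount_sum x : N x = \sum_y N2 x y.
Proof.
have e1 : N x = \sum_(t < T) (nth x0 (codom w) (k * t)%N == x)%:R.
  rewrite /N /Ncount natr_sum; apply: eq_bigr => t _; rewrite (Xopt_codom w x0) //.
  have := ltn_ord t; rewrite /nsteps /= leq_divRL // => h; lia.
rewrite e1 (sum_transitions (fun a _ => (a == x)%:R)) (bigD1 x) //= eqxx.
rewrite [X in _ + X]big1 => [|z zx]; last by rewrite big1 // => y _; rewrite (negbTE zx) mulr0.
by rewrite addr0; apply: eq_bigr => y _; rewrite mulr1.
Qed.

Variable alpha : R.
Hypothesis alpha_bound : 0 < alpha <= 1 / 4.
Hypothesis T_gt0 : (0 < T)%N.
Hypothesis small_deviation : forall v,
  `|\sum_(t < T) deviation P pi k x0 (codom w) v (k * t)%N| <= T%:R * alpha * dot v v.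

Let s_neq0 x : s 0 x != 0. Proof. by rewrite gt_eqF // sqrt_row_gt0. Qed.
Let s_sqr x : s 0 x ^+ 2 = pi 0 x. Proof. exact: sqrt_row_sqr. Qed.
Let T_pos : 0 < T%:R :> R. Proof. by rewrite ltr0n. Qed.

Let F (a b : 'rV[R]_n) := \sum_x \sum_y N2 x y * (a 0 x / s 0 x + b 0 y / s 0 y) ^+ 2.

Let F_near a b : `|F a b - T%:R * (dot a a + dot b b + 2 * dot (a *m L) b)| <=
  T%:R * alpha * (dot a a + dot b b).
Proof.
have := small_deviation (row_mx a b); rewrite dot_row_mx.
rewrite big_split /= sumrN sumr_const card_ord (mean_form_row_mx pi_gt0 hQ) -[X in _ - X]mulr_natl.
congr (`|_ - _| <= _).
rewrite (sum_transitions (fun x y => dot (row_mx a b) (sample_row pi x y) ^+ 2)).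
by apply: eq_bigr => x _; apply: eq_bigr => y _; rewrite dot_sample_row.
Qed.

Let G x := N x / (T%:R * pi 0 x).
Let M : 'M[R]_n := \matrix_(x, y) (N2 x y / (T%:R * s 0 x * s 0 y)).

(** The test vector [(e_x, 0)], on which the mean form is 1, isolates the occupation count of
    [x]. *)
Let G_near x : `|G x - 1| <= alpha.
Proof.
have d0 (u : 'rV[R]_n) : dot u 0 = 0 by rewrite dotC dot0l.
have := F_near (delta_mx 0 x) 0; rewrite !d0.
rewrite dot_delta mxE !eqxx mulr0 !addr0 !mulr1.
have -> : F (delta_mx 0 x) 0 = N x / pi 0 x.
  rewrite /F (bigD1 x) //= [X in _ + X]big1 => [|z zx]; last first.
    by apply: big1 => y _; rewrite !mxE (negbTE zx) andbF !mul0r addr0 expr0n mulr0.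
  rewrite addr0 Ncount_sum mulr_suml; apply: eq_bigr => y _.
  rewrite [delta_mx 0 x 0 x]mxE !eqxx [(0 : 'rV[R]_n) 0 y]mxE /= -s_sqr.
  by field; rewrite !s_neq0.
have -> : N x / pi 0 x - T%:R = T%:R * (G x - 1).
  by rewrite /G; field; rewrite !gt_eqF.
by rewrite normrM (gtr0_norm T_pos) ler_pM2l.
Qed.

Let M_near a b :
  `|dot (a *m M) b - dot (a *m L) b| <= alpha * (dot a a + dot b b) / 2.
Proof.
have h1 := F_near a b; have h2 := F_near a (- b).
rewrite !(dotNr, dotNl) opprK in h2.
(* Polarization: the occupation parts cancel and only the transition counts remain. *)
have e : F a b - F a (- b) = T%:R * (4 * dot (a *m M) b).
  rewrite /F -sumrB dotE mulrA mulr_sumr.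
  under eq_bigr do rewrite -sumrB.
  rewrite exchange_big /=; apply: eq_bigr => y _.
  rewrite [(a *m M) 0 y]mxE mulr_suml mulr_sumr; apply: eq_bigr => x _.
  rewrite [(- b) 0 y]mxE [M x y]mxE; field; by rewrite !s_neq0 gt_eqF.
rewrite ler_norml in h1; rewrite ler_norml in h2.
have /andP[h3 h4] := h1; have /andP[h5 h6] := h2.
rewrite -(ler_pM2l T_pos) -(gtr0_norm T_pos) -normrM (gtr0_norm T_pos).
have -> : T%:R * (dot (a *m M) b - dot (a *m L) b) =
   (F a b - F a (- b)) / 4 - T%:R * dot (a *m L) b by rewrite e; field.
rewrite ler_norml; apply/andP; split; lra.
Qed.

(** An unvisited state would give [|G x - 1| = 1 > alpha], so well-definedness costs no further
    probability. *)
Lemma counts_gt0 x : (0 < Ncount k w x)%N.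
Proof.
rewrite lt0n; apply/negP => /eqP h; have := G_near x.
rewrite /G /N h mul0r sub0r normrN1; have /andP[_ h1] := alpha_bound; lra.
Qed.

Lemma gamma_hat_near :
  `|gamma_hat_k w k - gamma_dagger pi (P ^+ k) / k%:R| <= 12 * alpha / k%:R.
Proof.
have kp : 0 < k%:R :> R by rewrite ltr0n.
rewrite /gamma_hat_k /gamma_mx gamma_dagger_symmetrize // -/L.
rewrite -mulrBl normrM normfV (gtr0_norm kp) ler_pM2r ?invr_gt0 //.
have hL x y : Lhat k w x y = M x y / (Num.sqrt (G x) * Num.sqrt (G y)).
  have N0 z : 0 < N z by rewrite ltr0n counts_gt0.
  have sG z : Num.sqrt (G z) = Num.sqrt (N z) / (Num.sqrt T%:R * s 0 z).
    rewrite /G sqrtrM ?ltW // sqrtrV ?mulr_ge0 ?ltW // sqrtrM ?ltW //.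
    by rewrite mxE.
  rewrite [LHS]mxE -/(N2 x y) -/(N x) -/(N y) sqrtrM ?ltW // !sG [M x y]mxE.
  have sT : Num.sqrt T%:R != 0 :> R by rewrite gt_eqF // sqrtr_gt0.
  have sN z : Num.sqrt (N z) != 0 by rewrite gt_eqF // sqrtr_gt0.
  have e : T%:R = Num.sqrt T%:R ^+ 2 :> R by rewrite sqr_sqrtr // ltW.
  rewrite [X in _ = _ / (X * _ * _) / _]e; move: (Num.sqrt T%:R) sT => r r0.
  by field; rewrite !sN r0 !s_neq0.
have gp v : `|dot (v *m (Lhat k w)^T) (v *m (Lhat k w)^T) - dot (v *m L^T) (v *m L^T)|
    <= 12 * alpha * dot v v.
  exact: (gram_perturb alpha_bound (symmetrize_nonexpansive pi_gt0 pi_sum hQ) G_near M_near v hL).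
have sg (A : 'M[R]_n) : (A^T *m A)^T = A^T *m A by rewrite trmx_mul trmxK.
have fg (A : 'M[R]_n) v : dot (v *m (A^T *m A)) v = dot (v *m A^T) (v *m A^T).
  by rewrite mulmxA [LHS]dot_mulmxl.
have h1 : lambda2 ((Lhat k w)^T *m Lhat k w) <= lambda2 (L^T *m L) + 12 * alpha.
  apply: lambda2_perturb => // v; rewrite !fg.
  by have := gp v; rewrite ler_norml => /andP[]; lra.
have h2 : lambda2 (L^T *m L) <= lambda2 ((Lhat k w)^T *m Lhat k w) + 12 * alpha.
  apply: lambda2_perturb => // v; rewrite !fg.
  by have := gp v; rewrite ler_norml => /andP[]; lra.
by rewrite ler_norml; apply/andP; split; lra.
Qed.

End Counts.

Section Truncation.
Context {n : nat} (n_gt1 : (1 < n)%N).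
Variables (P : 'M[R]_n) (pi : 'rV[R]_n).
Hypothesis sP : row_stochastic P.
Hypothesis primP : primitive P.
Hypothesis statP : stationary P pi.
Hypothesis pi_gt0 : forall x, 0 < pi 0 x.

(* Skips larger than [K >= 2/eps] contribute at most [1/k <= eps/2]. *)
Lemma gamma_ps_hat_near m (w : cpath n m.+1) K eps : (0 < K)%N -> 0 < eps -> 2 / eps <= K%:R ->
  (forall k, (0 < k <= K)%N ->
     `|gamma_hat_k w k - gamma_dagger pi (P ^+ k) / k%:R| <= eps / 2) ->
  `|gamma_ps_hat K w - gamma_ps pi P| <= eps.
Proof.
move=> K0 e0 Ke h.
have bounds := gamma_dagger_pow_bounds n_gt1 sP statP pi_gt0.
have lb k : (0 < k <= K)%N -> gamma_hat_k w k <= gamma_ps_hat K w.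
  move=> kK; apply: le_bigmax_seq => //; rewrite mem_index_iota; lia.
have ub : gamma_ps_hat K w <= gamma_ps pi P + eps / 2.
  have hk k : (0 < k <= K)%N -> gamma_hat_k w k <= gamma_ps pi P + eps / 2.
    move=> kK; have := h k kK; have k0 : (0 < k)%N by case/andP: kK.
    have := gamma_dagger_le_ps n_gt1 sP statP pi_gt0 k0.
    by rewrite ler_norml => ? /andP[]; lra.
  rewrite /gamma_ps_hat big_seq; apply: bigmax_le; first by apply: hk; rewrite K0.
  by move=> k; rewrite mem_index_iota => /hk.
have gt : gamma_ps pi P <= gamma_ps_hat K w + eps.
  apply: (gamma_ps_le n_gt1 sP statP pi_gt0) => k k0.
  have [kK|kK] := leqP k K.
    have kK' : (0 < k <= K)%N by rewrite k0.
    by have := h k kK'; have := lb k kK'; rewrite ler_norml => ? /andP[]; lra.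
  have h1 : gamma_dagger pi (P ^+ k) / k%:R <= eps / 2.
    have kp : 0 < k%:R :> R by rewrite ltr0n.
    rewrite ler_pdivrMr //; have /andP[_ g1] := bounds k; apply: (le_trans g1).
    have kK2 : K%:R <= k%:R :> R by rewrite ler_nat ltnW.
    by move: Ke; rewrite ler_pdivrMr // => Ke; have := ler_wpM2r (ltW e0) kK2; lra.
  (* The estimator is not known to be nonnegative; comparison at skip 1 with [gamma_dagger >= 0]
     bounds it below. *)
  have h2 : - (eps / 2) <= gamma_ps_hat K w.
    have K1 : (0 < 1 <= K)%N by [].
    have := h 1%N K1; have := lb 1%N K1; have /andP[g0 _] := bounds 1%N.
    by rewrite divr1 ler_norml => ? /andP[]; lra.
  lra.
by rewrite ler_norml; apply/andP; split; lra.
Qed.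

End Truncation.

Section SampleSize.

(** * Choice of the parameters and union bound *)

Lemma nat_ceil (x : R) : 0 <= x -> exists b : nat, x <= b%:R <= x + 1.
Proof.
move=> x0; exists (Num.truncn x).+1; have := truncn_itv x0 => /andP[h1 h2].
by rewrite (ltW h2) -natr1 lerD2r.
Qed.

Lemma expRN_lnV (z : R) : 0 < z -> expR (- ln z^-1) = z.
Proof. by move=> z0; rewrite lnV ?posrE // opprK lnK. Qed.

Lemma lnV_ge_half (z : R) : 0 < z -> z <= 1 / 2 -> 1 / 2 <= ln z^-1.
Proof.
move=> z0 z1; rewrite -ler_expR lnK ?posrE ?invr_gt0 //.
have h := @expR_le_quadratic _ (1 / 2 : R) (lexx _).
apply: (@le_trans _ _ 2); first by lra.
by rewrite -[2]invrK lef_pV2 ?posrE ?invr_gt0 //; lra.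
Qed.

Lemma lnV_le_inv (z : R) : 0 < z -> ln z^-1 <= z^-1.
Proof.
move=> z0; have zi : 0 < z^-1 by rewrite invr_gt0.
by rewrite -ler_expR lnK ?posrE //; apply: le_trans (expR_ge1Dx _); lra.
Qed.

Lemma lnV_anti (z t : R) : 0 < z -> z <= t -> ln t^-1 <= ln z^-1.
Proof.
move=> z0 zt; have t0 : 0 < t by apply: lt_le_trans zt.
by rewrite ler_ln ?posrE ?invr_gt0 // lef_pV2 ?posrE.
Qed.

Lemma mul_divn_add2 b k : (k * (b %/ k + 2) <= b + 2 * k)%N.
Proof. by rewrite mulnDr mulnC [(k * 2)%N]mulnC leq_add2r leq_trunc_div. Qed.

Lemma leq_skip_blocks k s i : (0 < k)%N -> (0 < s)%N -> (i <= k * s * (i.-1 %/ k %/ s).+1)%N.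
Proof.
move=> k0 s0; rewrite -divnMA mulnC; case: i => [|i] //=.
by apply: ltn_ceil; rewrite muln_gt0 k0.
Qed.

(* The factor 24 (48 * 32)^2 makes the exponent J (k eps / 48)^2 pi_star / 1024 of the tail
   bound at least 12 log (1 / (pi_star gamma_ps eps delta)), where J >= m / (2 k s); the
   factor 108 comes from k s <= 54 k log (1/(pi_star eps)) / gamma_ps and log (1/pi_star) >= 1/2. *)
Definition universal_constant : R := 108 * (24 * (48 * 32) ^+ 2).

Variables (n m K : nat) (ps g eps delta : R).
Hypothesis ps_bound : 0 < ps <= 1 / 2.
Hypothesis g_bound : 0 < g <= 1.
Hypothesis eps_bound : 0 < eps < 1.
Hypothesis delta_bound : 0 < delta < 1.
Hypothesis n_bound : n%:R * ps <= 1.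
Hypothesis K_bound : K%:R * eps <= 3.
Hypothesis m_large : universal_constant / (g * ps * eps ^+ 2) * ln ps^-1 *
  ln (ps * eps * delta)^-1 * ln (ps * g * eps * delta)^-1 <= m%:R.

Let cst_ge0 : 0 <= 24 * (48 * 32) ^+ 2 :> R.
Proof. exact: mulr_ge0 (ler0n _ _) (sqr_ge0 _). Qed.

Let cst_ge : 1000 <= 24 * (48 * 32) ^+ 2 :> R.
Proof.
rewrite expr2; have x48 : 48 <= 48 * 32 :> R by lra.
move: (48 * 32 : R) x48 => x x48.
by have := ler_pM (ler0n R 48) (ler0n R 48) x48 x48; lra.
Qed.

Let l := ln (ps * eps)^-1.
Let z := ps * g * eps * delta.
Let L3 := ln z^-1.
Let cst : R := 24 * (48 * 32) ^+ 2.

Let ps0 : 0 < ps. Proof. by case/andP: ps_bound. Qed.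
Let g0 : 0 < g. Proof. by case/andP: g_bound. Qed.
Let e0 : 0 < eps. Proof. by case/andP: eps_bound. Qed.
Let d0 : 0 < delta. Proof. by case/andP: delta_bound. Qed.
Let pe0 : 0 < ps * eps. Proof. exact: mulr_gt0. Qed.
Let z0 : 0 < z. Proof. by rewrite /z !mulr_gt0. Qed.
Let pe_half : ps * eps <= 1 / 2.
Proof.
have /andP[_ h] := ps_bound; have /andP[_ e1] := eps_bound; apply: le_trans h.
by rewrite ger_pMr // ltW.
Qed.
Let l_half : 1 / 2 <= l. Proof. exact: lnV_ge_half. Qed.
Let z_half : z <= 1 / 2.
Proof.
apply: le_trans pe_half; have /andP[_ h1] := g_bound; have /andP[_ h2] := delta_bound.
rewrite /z [leLHS](_ : _ = ps * eps * (g * delta)); last by ring.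
by rewrite ger_pMr //; apply: mulr_ile1 => //; exact: ltW.
Qed.
Let L3_half : 1 / 2 <= L3. Proof. exact: lnV_ge_half. Qed.

Let m_large' : 54 * cst * l * L3 / (g * ps * eps ^+ 2) <= m%:R.
Proof.
apply: le_trans m_large.
have h1 : 1 / 2 <= ln ps^-1 by apply: lnV_ge_half => //; case/andP: ps_bound.
have h2 : l <= ln (ps * eps * delta)^-1.
  apply: lnV_anti; first exact: mulr_gt0.
  by rewrite ger_pMr //; case/andP: delta_bound => _ /ltW.
rewrite -/z -/L3 /universal_constant -/cst.
set D := _ * eps ^+ 2; have D0 : 0 < D by rewrite !mulr_gt0 ?exprn_gt0.
rewrite [leLHS](_ : _ = 108 * cst / D * (1 / 2) * l * L3); last by field; rewrite gt_eqF.
have k0 : 0 <= 108 * cst / D by rewrite divr_ge0 ?(ltW D0) //; exact: (mulr_ge0 (ler0n _ _) cst_ge0).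
have l0 : 0 <= l by have := l_half; lra.
apply: ler_wpM2r; first by have := L3_half; lra.
have half0 : 0 <= 1 / 2 :> R by lra.
apply: ler_pM => //; first exact: mulr_ge0.
exact: ler_wpM2l.
Qed.

(* [b] is a mixing time, [s] the spacing of the samples within a residue class, [T] the number
   of k-step transitions and [J] the number of samples retained in each class: the first [s]
   transitions (burn-in) and the last [T mod s] ones are bounded crudely. *)
Lemma parameter_choice : exists b : nat,
  expR (1 / 2 - g * b%:R / 4) <= ps * eps / 768 /\
  forall k, (0 < k <= K)%N ->
  let s := (b %/ k + 2)%N in let T := (m.-1 %/ k)%N in let J := (T %/ s).-1 in
  [/\ (s <= T)%N, 4 * s%:R / ps <= T%:R * (k%:R * eps / 24) / 2 &
      4 * n%:R * s%:R * K%:R *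
      expR (- (J%:R * (k%:R * eps / 48) ^+ 2 * ps / 1024)) <= delta].
Proof.
have l0 : 0 < l by have := l_half; lra.
(* The constant 48 gives [g b / 4 >= 12 l], so with [y = ps eps <= 1 / 2] the mixing error is at
   most [2 y^12 <= y / 1024]. *)
have [b /andP[b1 b2]] : exists b : nat, 48 * l / g <= b%:R <= 48 * l / g + 1.
  by apply: nat_ceil; exact: (divr_ge0 (mulr_ge0 (ler0n _ _) (ltW l0)) (ltW g0)).
exists b; split.
  apply: (@le_trans _ _ (expR (1 / 2 - 12 * l))).
    rewrite ler_expR lerD2l lerN2.
    by move: b1; rewrite ler_pdivrMr // => b1; lra.
  have -> : 1 / 2 - 12 * l = 1 / 2 + 12%:R * (- l) by ring.
  rewrite exp.expRD expRM_natl expRN_lnV //.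
  have h := @expR_le_quadratic _ (1 / 2 : R) (lexx _).
  set y := ps * eps.
  have y11 : y ^+ 11 <= (1 / 2) ^+ 11 by apply: lerXn2r; rewrite ?nnegrE; [exact: ltW|lra|exact: pe_half].
  rewrite exprS; apply: (@le_trans _ _ (2 * (y * (1 / 2) ^+ 11))).
    have y0 : 0 <= y := ltW pe0.
    apply: ler_pM; [exact: expR_ge0|exact: mulr_ge0 y0 (exprn_ge0 _ y0)|by lra|exact: ler_wpM2l].
  by have := ltW pe0; rewrite -/y; lra.
move=> k /andP[k0 kK] s T J.
have kp : 1 <= k%:R :> R by rewrite ler1n.
have ke0 : 0 < k%:R * eps by rewrite mulr_gt0 // (lt_le_trans ltr01).
have ke3 : k%:R * eps <= 3.
  by apply: le_trans K_bound; rewrite ler_wpM2r ?ler_nat // ltW.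
have sp : 0 < s%:R :> R by rewrite ltr0n /s addn2.
have lg : 1 <= 2 * (l / g).
  have /andP[_ g1] := g_bound.
  by rewrite mulrA ler_pdivlMr //; have := l_half; lra.
have ks : k%:R * s%:R <= 54 * k%:R * (l / g).
  have ksn : (k * s <= b + 2 * k)%N by exact: mul_divn_add2.
  have : k%:R * s%:R <= b%:R + 2 * k%:R :> R.
    by rewrite -!natrM -natrD ler_nat.
  have e : 48 * l / g = 48 * (l / g) by rewrite mulrA.
  have := ler_wpM2l (ltW (lt_le_trans ltr01 kp)) lg.
  have := ler_wpM2r (ltW (lt_le_trans ltr01 lg)) kp.
  by rewrite e in b2; lra.
(* [U] is the number of samples per class before rounding. Rounding and burn-in give [J >= U - 2],
   which is at least [U / 2] since [U >= 300]. *)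
pose U : R := m%:R / (k%:R * s%:R).
have k0' : 0 < k%:R :> R by apply: lt_le_trans kp.
have ksp : 0 < k%:R * s%:R :> R by apply: mulr_gt0.
have U_ge : cst * L3 / (k%:R * ps * eps ^+ 2) <= U.
  rewrite /U ler_pdivlMr //; apply: le_trans m_large'.
  apply: (le_trans (ler_wpM2l _ ks)).
    rewrite divr_ge0 // ?mulr_ge0 ?exprn_ge0 ?cst_ge0 ?(ltW ps0) ?(ltW e0) //; last by have := L3_half; lra.
  rewrite le_eqVlt; apply/orP; left; apply/eqP; field.
  by rewrite !gt_eqF // (lt_le_trans ltr01).
have [_ e1] : True /\ eps <= 1 by split=> //; case/andP: eps_bound => _ /ltW.
pose A := L3 / (k%:R * ps * eps ^+ 2).
have den0 : 0 < k%:R * ps * eps ^+ 2 by rewrite !mulr_gt0 ?exprn_gt0.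
have UA : cst * A <= U by rewrite /A mulrA.
have L3h := L3_half.
have AE : A * (k%:R * ps * eps ^+ 2) = L3 by rewrite /A mulfVK ?gt_eqF.
have A0 : 0 <= A by rewrite divr_ge0 ?(ltW den0) //; lra.
have A3 : 1 / 3 <= A.
  rewrite ler_pdivlMr //; apply: le_trans L3h.
  have h1 : k%:R * eps * eps <= 3 * 1 by apply: ler_pM => //; exact: ltW.
  have /andP[_ h2] := ps_bound.
  have : k%:R * eps * eps * ps <= 3 * (1 / 2).
    by apply: ler_pM => //; [rewrite !mulr_ge0 // ltW|exact: ltW|lra].
  by rewrite expr2; lra.
pose q := (T %/ s)%N.
have Uq : U <= q%:R + 1.
  rewrite /U ler_pdivrMr // natr1 -!natrM ler_nat mulnC.
  by apply: leq_skip_blocks; rewrite // /s addn2.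
have c1000 : 1000 <= cst := cst_ge.
have cE : cst * A / 2 * (k%:R * eps / 48) ^+ 2 * ps / 1024 = 12 * L3 * k%:R.
  by rewrite -AE /cst; field.
have c0 : 0 <= cst := cst_ge0.
have E12 j : U / 2 <= j -> 12 * L3 <= j * (k%:R * eps / 48) ^+ 2 * ps / 1024.
  move=> Uj; apply: (@le_trans _ _ (cst * A / 2 * (k%:R * eps / 48) ^+ 2 * ps / 1024)).
    rewrite cE -[leLHS]mulr1; apply: ler_wpM2l kp.
    by apply: mulr_ge0 (ler0n _ _) _; lra.
  apply: ler_wpM2r; first by rewrite invr_ge0 ler0n.
  apply: ler_wpM2r; first exact: ltW.
  apply: ler_wpM2r; first exact: sqr_ge0.
  by apply: le_trans Uj; apply: ler_wpM2r UA; rewrite invr_ge0 ler0n.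
clear cE m_large m_large'; clearbody cst; clear cst_ge cst_ge0.
have U300 : 300 <= U by have := ler_wpM2l c0 A3; lra.
clearbody U A.
have q3 : 3 <= q%:R :> R by lra.
have q_gt0 : (0 < q)%N by rewrite -(ltr_nat R); lra.
have JE : J%:R = q%:R - 1 :> R.
  by rewrite -[in RHS](prednK q_gt0) -natr1 addrK.
have JU : U / 2 <= J%:R by rewrite JE; lra.
have Tq : s%:R * q%:R <= T%:R :> R by rewrite -natrM ler_nat mulnC leq_trunc_div.
split.
- by move: q_gt0; rewrite /q divn_gt0 // /s addn2.
- have h1 : 1 / 2 / ps <= A * (k%:R * eps).
    rewrite ler_pdivrMr // [leRHS](_ : _ = A * (k%:R * ps * eps ^+ 2) / eps).
      rewrite AE ler_pdivlMr //; apply: (@le_trans _ _ (1 / 2 * 1)); last by lra.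
      by apply: ler_wpM2l => //; lra.
    by field; rewrite gt_eqF.
  have h2 : 1000 * (1 / 2 / ps) <= U * (k%:R * eps).
    apply: (@le_trans _ _ (cst * (A * (k%:R * eps)))).
      have p0 : 0 <= 1 / 2 / ps by apply: divr_ge0 (ltW ps0); lra.
      exact: le_trans (ler_wpM2r p0 c1000) (ler_wpM2l c0 h1).
    by have := ler_wpM2r (ltW ke0) UA; rewrite (mulrA cst A).
  have h3 : s%:R * (U / 2) <= T%:R.
    by apply: le_trans Tq; apply: ler_wpM2l; [exact: ltW|lra].
  have h4 : s%:R * (U / 2) * (k%:R * eps) <= T%:R * (k%:R * eps).
    exact: (ler_wpM2r (ltW ke0) h3).
  have h5 := ler_wpM2l (ltW sp) h2.
  have i0 : 0 < ps^-1 by rewrite invr_gt0.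
  have si : 0 <= s%:R * ps^-1 by rewrite mulr_ge0 // ltW.
  lra.
- have {}E12 := E12 _ JU.
  have zE : expR (- (J%:R * (k%:R * eps / 48) ^+ 2 * ps / 1024)) <= z ^+ 12.
    rewrite -(expRN_lnV z0) -expRM_natl ler_expR -/L3.
    by rewrite mulrN lerN2.
  have sg : s%:R * (g * (ps * eps)) <= 54.
    have h1 : s%:R <= 54 * (l / g).
      by rewrite -(ler_pM2l k0') (_ : _ * (54 * _) = 54 * k%:R * (l / g)) //; ring.
    have h2 : l * (ps * eps) <= 1.
      apply: (@le_trans _ _ ((ps * eps)^-1 * (ps * eps))); last by rewrite mulVf ?gt_eqF.
      by apply: ler_wpM2r; [exact: ltW|exact: lnV_le_inv].
    apply: (@le_trans _ _ (54 * (l / g) * (g * (ps * eps)))).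
      by apply: ler_wpM2r => //; rewrite mulr_ge0 ?ltW.
    rewrite [leLHS](_ : _ = 54 * (l * (ps * eps))); last by field; rewrite gt_eqF.
    by lra.
  have a0 : 0 <= n%:R * ps := mulr_ge0 (ler0n _ _) (ltW ps0).
  have b0 : 0 <= s%:R * (g * (ps * eps)).
    exact: mulr_ge0 (ltW sp) (mulr_ge0 (ltW g0) (ltW pe0)).
  have Ke0 : 0 <= K%:R * eps := mulr_ge0 (ler0n _ _) (ltW e0).
  have prod := ler_pM (mulr_ge0 a0 b0) Ke0 (ler_pM a0 b0 n_bound sg) K_bound.
  have z10 : z ^+ 10 <= (1 / 2) ^+ 10.
    by apply: lerXn2r; rewrite ?nnegrE; [exact: ltW|lra|exact: z_half].
  have C0 : 0 <= 4 * n%:R * s%:R * K%:R :> R by rewrite !mulr_ge0.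
  apply: (le_trans (ler_wpM2l C0 zE)).
  (* Two of the twelve factors [z] pay for [n], [s] and [K], whose weighted product is at most
     [54 * 3], and supply [delta]; the other ten absorb the numerical constant. *)
  rewrite [leLHS](_ : _ = n%:R * ps * (s%:R * (g * (ps * eps))) * (K%:R * eps) *
    (4 * z ^+ 10) * (g * delta * delta)); last by rewrite /z; ring.
  have gd : g * delta * delta <= delta.
    have /andP[_ g1] := g_bound; have /andP[_ /ltW d1] := delta_bound.
    by rewrite -[leRHS]mul1r ler_wpM2r ?(ltW d0) //; apply: mulr_ile1 => //; exact: ltW.
  apply: le_trans gd; rewrite -[leRHS]mul1r; apply: ler_wpM2r; first by rewrite !mulr_ge0 ?ltW.
  apply: (@le_trans _ _ (1 * 54 * 3 * (4 * (1 / 2) ^+ 10))); last by lra.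
  have z4 : 0 <= 4 * z ^+ 10 := mulr_ge0 (ler0n _ _) (exprn_ge0 _ (ltW z0)).
  exact: ler_pM (mulr_ge0 (mulr_ge0 a0 b0) Ke0) z4 prod (ler_wpM2l (ler0n _ _) z10).
Qed.

End SampleSize.

Lemma Kparam_bounds (eps : R) : 0 < eps < 1 ->
  [/\ (0 < Kparam eps)%N, 2 / eps <= (Kparam eps)%:R & (Kparam eps)%:R * eps <= 3].
Proof.
move=> /andP[e0 e1]; have x0 : 0 < 2 / eps by rewrite divr_gt0.
have c0 : (0 <= Num.ceil (2 / eps))%R by rewrite ceil_ge0 // (lt_trans _ x0) // ltrN10.
have KE : (Kparam eps)%:R = (Num.ceil (2 / eps))%:~R :> R by rewrite /Kparam natr_absz ger0_norm.
have /andP[h1 h2] := ceil_itv (2 / eps).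
have h3 : 2 / eps <= (Kparam eps)%:R by rewrite KE.
split=> //; first by rewrite -(ltr_nat R) (lt_le_trans x0).
rewrite intrB -KE ltrBlDr in h1.
have : (2 / eps + 1) * eps <= 3 by rewrite mulrDl mul1r divfK ?gt_eqF //; lra.
by apply: le_trans; rewrite ler_wpM2r ?ltW.
Qed.

Lemma residue_fits k r s J T m : (0 < k)%N -> (r < s)%N -> (s * J.+1 <= T)%N -> (k * T <= m)%N ->
  (k * r + k + J * (k * s.-1 + k) <= m)%N.
Proof.
move=> k0 rs sJ kT; apply: leq_trans kT.
rewrite -!mulnSr (ltn_predK rs); apply: (@leq_trans (k * (s * J.+1))); last by rewrite leq_mul2l sJ orbT.
by rewrite mulnCA -mulnDr leq_mul2l mulnS [(s * J)%N]mulnC leq_add2r rs orbT.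
Qed.

(** The waiting time [k r + k] is the end of transition [r]. The gap is [k * s.-1] because a sampled
    transition itself takes [k] of the [k s] steps. *)
Lemma residue_position k r s j : (0 < s)%N ->
  (k * (r + s * j.+1) = k * r + k + k * s.-1 + j * (k * s.-1 + k))%N.
Proof. by case: s => // s _ /=; nia. Qed.

(** * Union over residue classes and signs for one skip *)

Section Assembly.
Context {n m : nat} (n_gt1 : (1 < n)%N).
Variables (P : 'M[R]_n) (pi mu : 'rV[R]_n).
Hypothesis sP : row_stochastic P.
Hypothesis statP : stationary P pi.
Hypothesis pi_gt0 : forall x, 0 < pi 0 x.
Hypothesis mu_dist : is_distribution mu.
Variables (k s : nat) (x0 : 'I_n) (alpha : R).
Hypothesis k_gt0 : (0 < k)%N.
Hypothesis s_gt0 : (0 < s)%N.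

Let T := (m %/ k)%N.
Let J := (T %/ s).-1.
Let ps := pi_star pi.

Hypothesis s_le : (s <= T)%N.
Hypothesis alpha_bound : 0 < alpha <= 1.
Hypothesis burn_in : 4 * s%:R / ps <= T%:R * alpha / 2.

Definition bad_residue (r : nat) (sg : bool) (w : cpath n m.+1) : bool :=
  `[< large_deviation P pi k x0 (alpha / 2) sg J
        (fun j => k * r + k + k * s.-1 + j * (k * s.-1 + k))%N (codom w) >].

Definition bad_skip (w : cpath n m.+1) : bool :=
  has (fun r => has (fun sg => bad_residue r sg w) [:: true; false]) (iota 0 s).

Let q_gt0 : (0 < T %/ s)%N. Proof. by rewrite divn_gt0. Qed.
Let sJ : (s * J.+1 <= T)%N. Proof. by rewrite prednK // mulnC leq_trunc_div. Qed.
Let hQ : preserves pi (P ^+ k) := preservesX k (conj sP (proj2 statP)).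

(** Half of [alpha] is spent on the residue classes, the other half on the [2 s] boundary terms,
    each at most [2 / ps]; this is what [burn_in] provides. *)
Lemma small_deviation (w : cpath n m.+1) v : ~~ bad_skip w ->
  `|\sum_(t < nsteps m.+1 k) deviation P pi k x0 (codom w) v (k * t)%N| <=
  T%:R * alpha * dot v v.
Proof.
move=> /hasPn good; have /andP[a0 _] := alpha_bound.
have V0 := dotvv_ge0 v; have ps0 : 0 < ps := pi_star_gt0 pi_gt0.
have hdev t : `|deviation P pi k x0 (codom w) v t| <= 2 / ps * dot v v.
  exact: (deviation_le n_gt1 statP pi_gt0 hQ).
(* [large_deviation] needs a nonzero test vector, so [v = 0] is treated apart. *)
have [v0|vn0] := eqVneq (dot v v) 0.
  rewrite v0 mulr0 (le_trans (ler_norm_sum _ _ _)) // big1 // => t _.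
  by apply/eqP; rewrite eq_le normr_ge0 andbT; have := hdev (k * t)%N; rewrite v0 mulr0.
have vnz : v != 0 by rewrite -dotvv_eq0.
apply: (le_trans (@sum_residues (fun t => deviation P pi k x0 (codom w) v (k * t)%N) s J
  (nsteps m.+1 k) (J%:R * (alpha / 2) * dot v v) (2 / ps * dot v v) s_gt0 sJ _ _ _)).
- by rewrite /J prednK // mulnC ltnW // ltn_ceil.
- move=> r rs; have := good r; rewrite mem_iota add0n rs => /(_ isT).
  have -> : \sum_(j < J) deviation P pi k x0 (codom w) v (k * (r + s * j.+1))%N =
      \sum_(j < J) deviation P pi k x0 (codom w) v (k * r + k + k * s.-1 + j * (k * s.-1 + k))%N.
    apply: eq_bigr => j _; congr deviation.
    exact: residue_position.
  move=> /hasPn h.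
  have /asboolPn h1 := h true isT; have /asboolPn h2 := h false isT.
  rewrite ler_norml; apply/andP; split; rewrite leNgt; apply/negP => hlt.
  + by apply: h1; exists v => //; rewrite expr1 mulN1r; lra.
  + by apply: h2; exists v => //; rewrite expr0 mul1r ltW.
- by move=> t; apply: hdev.
have sJT : s%:R * J%:R <= T%:R :> R.
  by rewrite -natrM ler_nat (leq_trans _ sJ) // leq_mul2l leqnSn orbT.
have h1 : s%:R * J%:R * (alpha / 2 * dot v v) <= T%:R * (alpha / 2 * dot v v).
  by apply: ler_wpM2r => //; rewrite mulr_ge0 // divr_ge0 // ltW.
have h2 := ler_wpM2r V0 burn_in.
by lra.
Qed.

Hypothesis mix : forall x y,
  `|(P ^+ (k * s.-1)) x y - pi 0 y| <= alpha / 2 / 16 * pi 0 y.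

Lemma bad_skip_prob : prob mu P bad_skip <=
  4 * n%:R * s%:R * expR (- (J%:R * (alpha / 2) ^+ 2 * ps / 1024)).
Proof.
have /andP[a0 a1] := alpha_bound.
apply: (le_trans (prob_has sP mu_dist _ _)).
set E := expR _.
apply: (@le_trans _ _ (\sum_(r <- iota 0 s) 2 * (2 * n%:R * E))).
  rewrite big_seq [leRHS]big_seq; apply: ler_sum => r; rewrite mem_iota add0n => /andP[_ rs].
  apply: (le_trans (prob_has sP mu_dist _ _)).
  rewrite !big_cons big_nil addr0 [leRHS](_ : _ = 2 * n%:R * E + 2 * n%:R * E); last by ring.
  have kT : (k * T <= m)%N by rewrite mulnC leq_trunc_div.
  have a2 : 0 < alpha / 2 <= 1 by apply/andP; split; lra.
  have bound sg := deviation_tail n_gt1 sP statP pi_gt0 mu_dist x0 sg a2 mix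
    (residue_fits k_gt0 rs sJ kT).
  exact: lerD (bound true) (bound false).
by rewrite big_const_seq count_predT size_iota iter_addr_0 -mulr_natl; lra.
Qed.

End Assembly.

Theorem mainTheorem9 :
  exists c : R, 0 < c /\
  forall (n : nat) (P : 'M[R]_n) (pi mu : 'rV[R]_n) (eps delta : R) (m : nat),
    (1 < n)%N ->
    row_stochastic P -> primitive P ->
    stationary P pi -> (forall x, 0 < pi 0 x) ->
    is_distribution mu ->
    0 < eps < 1 -> 0 < delta < 1 ->
    let ps := pi_star pi in
    let g := gamma_ps pi P in
    let K := Kparam eps in
    c / (g * ps * eps ^+ 2) * ln (ps^-1) * ln ((ps * eps * delta)^-1)
      * ln ((ps * g * eps * delta)^-1) <= m%:R ->
    1 - delta <=
      prob mu P (fun w : cpath n m =>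
        well_defined_K K w && (`|gamma_ps_hat K w - g| <= eps)).
Proof.
exists universal_constant; split.
  by rewrite /universal_constant !mulr_gt0 ?exprn_gt0 // ltr0n.
move=> n P pi mu eps delta m n1 sP primP statP pi0 mu_dist e01 d01 ps g K hm.
have /andP[e0 e1] := e01; have /andP[d0 d1] := d01.
have [K0 K2 K3] := Kparam_bounds e01; rewrite -/K in K0 K2 K3.
have ps0 : 0 < ps := pi_star_gt0 pi0.
have g0 : 0 < g := gamma_ps_gt0 n1 sP primP statP pi0.
have psb : 0 < ps <= 1 / 2 by rewrite ps0 (pi_star_le_half n1 statP pi0).
have gb : 0 < g <= 1 by rewrite g0 (gamma_ps_le1 n1 sP statP pi0).
have [b [hb hk]] := parameter_choice psb gb e01 d01 (card_pi_star statP) K3 hm.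
(* For [m = 0], skip 1 would require [s <= 0], whereas [s >= 2]. *)
case: m hm hk => [|m] hm hk.
  have [] := hk 1%N (_ : (0 < 1 <= K)%N); first by rewrite K0.
  by rewrite divn1 leqn0 addn2.
have x0 : 'I_n := Ordinal (ltn_trans (ltnSn 0) n1).
(* [alpha k] is chosen so that the error [12 alpha / k] of [gamma_hat_near] equals [eps / 2]. *)
pose s k := (b %/ k + 2)%N; pose alpha k : R := k%:R * eps / 24.
pose bad k := bad_skip P pi k (s k) x0 (alpha k) : pred (cpath n m.+1).
have s0 k : (0 < s k)%N by rewrite /s addn2.
have ab k : (0 < k <= K)%N -> 0 < alpha k <= 1 / 4.
  move=> /andP[k0 kK]; have kp : 0 < k%:R * eps by rewrite mulr_gt0 ?ltr0n.
  have : k%:R * eps <= 3 by apply: le_trans K3; rewrite ler_wpM2r ?ler_nat // ltW.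
  by rewrite /alpha => ?; apply/andP; split; lra.
have ab1 k : (0 < k <= K)%N -> 0 < alpha k <= 1.
  by move=> /ab/andP[h1 h2]; apply/andP; split; lra.
have burn k : (0 < k <= K)%N -> 4 * (s k)%:R / ps <= (m %/ k)%:R * alpha k / 2.
  by move=> kK; have [_ h _] := hk k kK.
rewrite (prob_setC sP mu_dist) lerD2l lerN2.
apply: (@le_trans _ _ (prob mu P (fun w : cpath n m.+1 => has (fun k => bad k w) (iota 1 K)))).
  apply: prob_le => // w; rewrite unfold_in /= => ng; rewrite unfold_in.
  apply: contraR ng => /hasPn good.
  have goodk k : (0 < k <= K)%N -> ~~ bad k w.
    by move=> kK; apply: good; rewrite mem_iota add1n ltnS.
  have dev k v : (0 < k <= K)%N ->
      `|\sum_(t < nsteps m.+1 k) deviation P pi k x0 (codom w) v (k * t)%N| <=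
      (nsteps m.+1 k)%:R * alpha k * dot v v.
    move=> kK; have /andP[k0 _] := kK; have [sT _ _] := hk k kK.
    exact: (small_deviation n1 sP statP pi0 (s0 k) sT (ab1 k kK) (burn k kK) v (goodk k kK)).
  have Tk k : (0 < k <= K)%N -> (0 < nsteps m.+1 k)%N.
    by move=> kK; have [sT _ _] := hk k kK; apply: leq_trans sT; rewrite addn2.
  apply/andP; split.
    apply/forallP => k; apply/implyP => k0; apply/forallP => x.
    have kK : (0 < k <= K)%N by rewrite k0 -ltnS ltn_ord.
    exact: (counts_gt0 n1 sP statP pi0 k0 (ab k kK) (Tk k kK) (fun v => dev k v kK)).
  apply: (gamma_ps_hat_near n1 sP statP pi0 K0 e0 K2) => k kK.
  have /andP[k0 _] := kK; have kp : 0 < k%:R :> R by rewrite ltr0n.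
  apply: (le_trans (gamma_hat_near n1 sP statP pi0 k0 (ab k kK) (Tk k kK) (fun v => dev k v kK))).
  by rewrite ler_pdivrMr // /alpha; lra.
apply: (le_trans (prob_has sP mu_dist _ _)).
have Kp : 0 < K%:R :> R by rewrite ltr0n.
apply: (@le_trans _ _ (\sum_(k <- iota 1 K) delta / K%:R)); last first.
  rewrite big_const_seq count_predT size_iota iter_addr_0 -[leLHS]mulr_natl.
  by rewrite mulrCA divff ?mulr1 // gt_eqF.
rewrite big_seq [leRHS]big_seq; apply: ler_sum => k; rewrite mem_iota add1n ltnS => kK.
have /andP[k0 _] := kK; have [sT _ hE] := hk k kK.
have mix x y : `|(P ^+ (k * (s k).-1)) x y - pi 0 y| <= alpha k / 2 / 16 * pi 0 y.
  apply: (le_trans (mixing n1 sP primP statP pi0 _ x y)); apply: ler_wpM2r; first exact: ltW.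
  (* The required relative mixing error is [alpha k / 32 = k eps / 768]; the factor [ps] compensates
     the [1 / pi_star] in [mixing]. *)
  rewrite ler_pdivrMr //; apply: (@le_trans _ _ (ps * eps / 768)); last first.
    have k1 : 1 <= k%:R :> R by rewrite ler1n.
    have := ler_wpM2r (ltW (mulr_gt0 ps0 e0)) k1.
    by rewrite /alpha -/ps; lra.
  apply: le_trans hb; rewrite ler_expR lerD2l lerN2 -/g.
  apply: ler_wpM2r; first by rewrite invr_ge0 ler0n.
  apply: ler_wpM2l; first exact: ltW.
  by rewrite ler_nat /s addn2 /= mulnC ltnW // ltn_ceil.
apply: (le_trans (bad_skip_prob n1 sP statP pi0 mu_dist x0 k0 (s0 k) sT (ab1 k kK) mix)).
rewrite ler_pdivlMr //; apply: le_trans hE; rewrite mulrAC.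
have -> : alpha k / 2 = k%:R * eps / 48 by rewrite /alpha; field.
by [].
Qed.
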